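(* Let $1\le r\le n$. For every full-rank $V\in\mathbb{R}^{n\times r}_*$, with $W=V^TY$, and every realization $y\in\mathbb{R}^n$ of $Y$, the following equalities hold: $$\mathcal{I}(W,X)=\frac12\log\det\left(\left(V^TC_YV\right)\left(V^TC_EV\right)^{-1}\right),$$ $$H\left(P(X\mid W=V^Ty)\right)=-\mathcal{I}(W,X)+\frac12\log\det C_X+\frac q2\log(2\pi e).$$ As a consequence, the maximization of $\mathcal{I}(W,X)$ and the minimization of $H(P(X\mid W=V^Ty))$ with respect to $V\in\mathbb{R}^{n\times r}_*$ admit the same solutions for any realization $y$ of $Y$. Moreover, $$\max_{V\in\mathbb{R}^{n\times r}_*}\mathcal{I}(W,X)=\frac12\sum_{i=1}^r\log\lambda_i,$$ where $(\lambda_i)_{i=1}^r$ are the $r$ dominant (largest, counted with multiplicity) eigenvalues of the generalized eigenvalue problem $$C_Yv=\lambda C_Ev,\qquad\lambda\in\mathbb{R},\ v\in\mathbb{R}^n.$$ A solution to this maximization problem is given by the matrix $V\in\mathbb{R}^{n\times r}_*$ whose columns are eigenvectors $(v_i)_{i=1}^r$ of this generalized eigenvalue problem associated to the dominant eigenvalues $(\lambda_i)_{i=1}^r$.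
   Context: Linear Gaussian model: $Y=BX+E$ with $B\in\mathbb{R}^{n\times q}$ deterministic, $X\sim\mathcal{N}(m_X,C_X)$ in $\mathbb{R}^q$ and $E\sim\mathcal{N}(m_E,C_E)$ in $\mathbb{R}^n$ independent, $C_X$ and $C_E$ symmetric positive definite. $C_Y=BC_XB^T+C_E$ is the covariance of $Y$. $\mathbb{R}^{n\times r}_*$ is the set of full-rank matrices in $\mathbb{R}^{n\times r}$; $P(X\mid W=V^Ty)$ is the posterior distribution of $X$ given $W=V^Ty$. The (differential) entropy of a random vector $Z$ with density $f_Z$ is $H(Z)=H(P(Z))=\mathbb{E}_Z(-\log f_Z(Z))$, and the mutual information is $\mathcal{I}(Z_0,Z_1)=H(Z_0)+H(Z_1)-H(Z_0,Z_1)$, where $H(Z_0,Z_1)$ is the entropy of the joint distribution of $(Z_0,Z_1)$. *)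

(* Defs.v *)
From HB Require Import structures.
From mathcomp Require Import all_boot all_order all_algebra.
From mathcomp Require Import all_classical all_reals all_analysis.
From mathcomp Require Import measurable_realfun.

Set Implicit Arguments.
Unset Strict Implicit.
Unset Printing Implicit Defensive.

Import Order.TTheory GRing.Theory Num.Theory.
Import numFieldNormedType.Exports.

Local Open Scope classical_set_scope.
Local Open Scope ring_scope.

(* The sigma-algebra on matrices is generated by the entries, as for tuples;
   on ['cV[R]_n] it is the Borel sigma-algebra of R^n. *)

Definition measure_matrix_display : measure_display -> measure_display.
Proof. exact. Qed.

Section measurable_matrix.
Context (R : realType) (m n : nat).

Definition mx_cylinders : set (set 'M[R]_(m, n)) :=
  [set A | exists i j (C : set R),
     measurable C /\ A = (fun M : 'M[R]_(m, n) => M i j) @^-1` C].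

Let mx_set0 : <<s mx_cylinders >> set0.
Proof. exact: sigma_algebra0. Qed.

Let mx_setC A : <<s mx_cylinders >> A -> <<s mx_cylinders >> (~` A).
Proof. exact: sigma_algebraC. Qed.

Let mx_bigcup (F : (set 'M[R]_(m, n))^nat) :
  (forall i, <<s mx_cylinders >> (F i)) ->
  <<s mx_cylinders >> (\bigcup_i (F i)).
Proof. exact: sigma_algebra_bigcup. Qed.

HB.instance Definition _ :=
  @isMeasurable.Build (measure_matrix_display default_measure_display)
    'M[R]_(m, n) <<s mx_cylinders >> mx_set0 mx_setC mx_bigcup.

End measurable_matrix.

Lemma measurable_mxcoord (R : realType) m n (i : 'I_m) (j : 'I_n) :
  measurable_fun [set: 'M[R]_(m, n)] (fun M : 'M[R]_(m, n) => M i j).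
Proof.
move=> _ C mC; rewrite setTI; apply: sub_sigma_algebra.
by exists i, j, C.
Qed.

Lemma measurable_fun_mxP d (T : measurableType d) (R : realType) m n
    (f : T -> 'M[R]_(m, n)) :
  measurable_fun [set: T] f <->
  forall i j, measurable_fun [set: T] (fun t => f t i j).
Proof.
split=> [mf i j|mf].
  by apply: (measurableT_comp (measurable_mxcoord i j)).
apply: (measurability (@mx_cylinders R m n)) => //.
move=> _ [_ [i [j [C [mC ->]]]] <-].
exact: (mf i j).
Qed.

(* Lebesgue measure on R^n, built one coordinate at a time:
   [cV_cons (x, v)] is the column with first entry [x] and remaining ones [v]. *)

Definition cV_cons (R : realType) n (p : R * 'cV[R]_n) : 'cV[R]_n.+1 :=
  \col_i if unlift ord0 i is Some j then p.2 j 0 else p.1.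

Fixpoint lebesgue_cV (R : realType) n : set 'cV[R]_n -> \bar R :=
  match n with
  | 0 => dirac (0 : 'cV[R]_0)
  | n'.+1 => pushforward (lebesgue_measure \x @lebesgue_cV R n')%E
               (@cV_cons R n')
  end.

Section lebesgue_cV_measure.
Context (R : realType).

Lemma measurable_cV_cons n : measurable_fun setT (@cV_cons R n).
Proof.
apply/measurable_fun_mxP => i j; rewrite /cV_cons.
under eq_fun do rewrite mxE.
case: unliftP => [k|] _; last exact: measurable_fst.
exact: (measurableT_comp (measurable_mxcoord k 0) measurable_snd).
Qed.

Definition cV_uncons n (v : 'cV[R]_n.+1) : R * 'cV[R]_n :=
  (v ord0 0, \col_i v (lift ord0 i) 0).

Lemma measurable_cV_uncons n : measurable_fun setT (@cV_uncons n).
Proof.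
apply: measurable_fun_pair; first exact: measurable_mxcoord.
apply/measurable_fun_mxP => i j; under eq_fun do rewrite mxE.
exact: measurable_mxcoord.
Qed.

Lemma cV_consK n : cancel (@cV_cons R n) (@cV_uncons n).
Proof.
move=> [x v]; rewrite /cV_uncons /cV_cons mxE unlift_none; congr pair.
by apply/matrixP => i j; rewrite !mxE liftK ord1.
Qed.

End lebesgue_cV_measure.

Section lebesgue_cV_instance.
Context (R : realType).

Section step.
Context (n : nat) (mu : {sigma_finite_measure set 'cV[R]_n -> \bar R}).

Let mF := measurable_cV_cons (R := R) (n := n).

Let step := pushforward (lebesgue_measure \x mu)%E (@cV_cons R n).

Let step0 : step set0 = 0%E.
Proof. exact: measure0. Qed.

Let step_ge0 A : (0 <= step A)%E.
Proof. exact: measure_ge0. Qed.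

Let step_sigma_additive : semi_sigma_additive step.
Proof. exact: measure_semi_sigma_additive. Qed.

HB.instance Definition _ := isMeasure.Build _ _ _ step
  step0 step_ge0 step_sigma_additive.

Let step_sigma_finite : sigma_finite setT step.
Proof.
have [F FT Ffin] : sigma_finite setT (lebesgue_measure \x mu)%E.
  have /sigma_finiteP[G [GT ndG Gfin]] :=
    sigma_finiteT (@lebesgue_measure R).
  have /sigma_finiteP[H [HT ndH Hfin]] := sigma_finiteT mu.
  exists (fun i => G i `*` H i) => [|i].
    rewrite -setXTT GT HT predeqE => -[x y]; split.
      move=> [/= [i _ Gx] [k _ Hy]]; exists (maxn i k) => //; split.
      - by move: x Gx; exact/subsetPset/ndG/leq_maxl.
      - by move: y Hy; exact/subsetPset/ndH/leq_maxr.
    by move=> [i _ [/= ? ?]]; split; exists i.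
  have [? ?] := Gfin i; have [? ?] := Hfin i; split; first exact: measurableX.
  by rewrite product_measure1E// lte_mul_pinfty// ge0_fin_numE.
exists (fun i => @cV_uncons R n @^-1` F i).
  by rewrite -preimage_bigcup -FT preimage_setT.
move=> i; have [mFi Fi] := Ffin i; split.
  by rewrite -[X in measurable X]setTI; exact: measurable_cV_uncons.
rewrite /step /pushforward -comp_preimage.
suff -> : @cV_uncons R n \o @cV_cons R n = idfun by [].
by apply/funext => p /=; rewrite cV_consK.
Qed.

HB.instance Definition _ := @Measure_isSigmaFinite.Build _ _ _ step
  step_sigma_finite.

Definition lebesgue_cV_step : {sigma_finite_measure set 'cV[R]_n.+1 -> \bar R} :=
  step.

End step.

Lemma lebesgue_cV_bundled n :
  {mu : {sigma_finite_measure set 'cV[R]_n -> \bar R} |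
    mu = @lebesgue_cV R n :> (set _ -> _)}.
Proof.
elim: n => [|n [mu muE]]; first by exists (dirac (0 : 'cV[R]_0)).
by exists (lebesgue_cV_step mu); rewrite /= -muE.
Qed.

Context (n : nat).
Let mu := @lebesgue_cV R n.

Let mu0 : mu set0 = 0%E.
Proof. by rewrite /mu; case: (lebesgue_cV_bundled n) => m <-; exact: measure0. Qed.

Let mu_ge0 A : (0 <= mu A)%E.
Proof.
by rewrite /mu; case: (lebesgue_cV_bundled n) => m <-; exact: measure_ge0.
Qed.

Let mu_sigma_additive : semi_sigma_additive mu.
Proof.
rewrite /mu; case: (lebesgue_cV_bundled n) => m <-.
exact: measure_semi_sigma_additive.
Qed.

HB.instance Definition _ := isMeasure.Build _ _ _ (@lebesgue_cV R n)
  mu0 mu_ge0 mu_sigma_additive.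

Let mu_sigma_finite : sigma_finite setT mu.
Proof.
by rewrite /mu; case: (lebesgue_cV_bundled n) => m <-; exact: sigma_finiteT.
Qed.

HB.instance Definition _ := @Measure_isSigmaFinite.Build _ _ _
  (@lebesgue_cV R n) mu_sigma_finite.

End lebesgue_cV_instance.

Lemma lebesgue_cV_box (R : realType) n (A : 'I_n -> set R) :
  (forall i, measurable (A i)) ->
  lebesgue_cV [set v : 'cV[R]_n | forall i, A i (v i 0)] =
  (\prod_(i < n) lebesgue_measure (A i : set (measurableTypeR R)))%E.
Proof.
elim: n A => [|n IHn] A mA.
  rewrite big_ord0 /= diracE mem_set//= => i; by case: i.
rewrite big_ord_recl -(IHn (fun i => A (lift ord0 i)))//= /pushforward.
rewrite -product_measure1E//; first last.
- rewrite (_ : [set v | _] = \bigcap_(i in [set: 'I_n])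
      ((fun v : 'cV[R]_n => v i 0) @^-1` (A (lift ord0 i)))); last first.
    by apply/seteqP; split=> [v vA i _|v vA i]; [exact: vA|exact: (vA i I)].
  apply: fin_bigcap_measurable => // i _; rewrite -[X in measurable X]setTI.
  exact: measurable_mxcoord.
- exact: (mA ord0).
congr (product_measure1 _ _ _).
apply/seteqP; split=> [[x v] /= vA|[x v] /= [Ax vA] i].
  split=> [|i]; first by have := vA ord0; rewrite mxE unlift_none.
  by have := vA (lift ord0 i); rewrite mxE liftK.
by rewrite mxE; case: unliftP => [j|] ->.
Qed.

Definition sym_posdef (R : realType) n (C : 'M[R]_n) : Prop :=
  C^T = C /\ forall v : 'cV[R]_n, v != 0 -> 0 < (v^T *m C *m v) 0 0.

Definition full_rank (R : realType) m n (V : 'M[R]_(m, n)) : Prop :=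
  \rank V = minn m n.

(* Dimension of [{v | A v = l B v}]; mathcomp kernels act on row vectors,
   whence the transpose. *)
Definition geigen_mult (R : realType) n (A B : 'M[R]_n) (l : R) : nat :=
  \rank (kermx (A - l *: B)^T).

(* [lam] lists the eigenvalues of [A v = l B v] in nonincreasing order, each one
   repeated according to its multiplicity; lists of another length than [n] do
   not occur for [A] symmetric and [B] symmetric positive definite. *)
Definition geigenvalues (R : realType) n (A B : 'M[R]_n) (lam : n.-tuple R) :
    Prop :=
  sorted >=%R lam /\ forall l : R, count_mem l lam = geigen_mult A B l.

Section density.
Context d (T : measurableType d) (R : realType).
Implicit Types mu nu : set T -> \bar R.

Definition is_density mu nu (f : T -> R) : Prop :=
  [/\ measurable_fun [set: T] f, forall x, 0 <= f x &
      forall A, measurable A -> nu A = (\int[mu]_(x in A) (f x)%:E)%E].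

(* A density of [nu] with respect to [mu] chosen among those in [S], or 0 if
   there is none. *)
Definition density_in (S : set (T -> R)) mu nu : T -> R :=
  xget (cst 0) [set f | S f /\ is_density mu nu f].

Lemma density_in_measurable S mu nu :
  measurable_fun [set: T] (density_in S mu nu).
Proof. by rewrite /density_in; case: xgetP => [f _ [_ []]|]. Qed.

Lemma density_in_ge0 S mu nu x : 0 <= density_in S mu nu x.
Proof. by rewrite /density_in; case: xgetP => [f _ [_ []]|]. Qed.

(* E(- ln f(Z)) for Z of law [nu] and density [f]. As densities are unique
   almost everywhere, the choice of [f] is irrelevant. The entropy is
   extended-real-valued; a finite value means that [- ln f] is integrable. *)
Definition entropy mu nu : \bar R :=
  (\int[nu]_x (- ln (density_in setT mu nu x))%:E)%E.

End density.

Section random_vectors.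
Context d (T : measurableType d) (R : realType).

Lemma measurable_mulmx_cV m n (A : 'M[R]_(m, n)) (X : {mfun T >-> 'cV[R]_n}) :
  measurable_fun [set: T] (fun t => A *m X t).
Proof.
apply/measurable_fun_mxP => i j.
under eq_fun do rewrite mxE.
apply: measurable_sum => k; apply: measurable_funM => //.
by move: k j; apply/measurable_fun_mxP.
Qed.

Lemma measurable_add_cV n (X Y : {mfun T >-> 'cV[R]_n}) :
  measurable_fun [set: T] (fun t => X t + Y t).
Proof.
apply/measurable_fun_mxP => i j.
under eq_fun do rewrite mxE.
by apply: measurable_funD; move: i j; apply/measurable_fun_mxP.
Qed.

Definition rv_mulmx m n (A : 'M[R]_(m, n)) (X : {mfun T >-> 'cV[R]_n}) :
  T -> 'cV[R]_m := fun t => A *m X t.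

HB.instance Definition _ m n (A : 'M[R]_(m, n)) X :=
  isMeasurableFun.Build _ _ _ _ (rv_mulmx A X) (measurable_mulmx_cV A X).

Definition rv_add n (X Y : {mfun T >-> 'cV[R]_n}) : T -> 'cV[R]_n :=
  fun t => X t + Y t.

HB.instance Definition _ n (X Y : {mfun T >-> 'cV[R]_n}) :=
  isMeasurableFun.Build _ _ _ _ (rv_add X Y) (measurable_add_cV X Y).

Definition rv_pair d1 d2 (T1 : measurableType d1) (T2 : measurableType d2)
    (X : {mfun T >-> T1}) (Y : {mfun T >-> T2}) : T -> T1 * T2 :=
  fun t => (X t, Y t).

HB.instance Definition _ d1 d2 (T1 : measurableType d1)
    (T2 : measurableType d2) (X : {mfun T >-> T1}) (Y : {mfun T >-> T2}) :=
  isMeasurableFun.Build _ _ _ _ (rv_pair X Y)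
    (measurable_fun_pair (measurable_funPT X) (measurable_funPT Y)).

End random_vectors.

Section probability.
Context d (T : measurableType d) (R : realType) (P : probability T R).

Definition independent_rv d1 d2 (T1 : measurableType d1)
    (T2 : measurableType d2) (X : {RV P >-> T1}) (Y : {RV P >-> T2}) : Prop :=
  forall A B, measurable A -> measurable B ->
    P (X @^-1` A `&` Y @^-1` B) = (P (X @^-1` A) * P (Y @^-1` B))%E.

Definition gaussian_pdf n (m : 'cV[R]_n) (C : 'M[R]_n) (x : 'cV[R]_n) : R :=
  (Num.sqrt ((2 * pi) ^+ n * \det C))^-1 *
  expR (- ((x - m)^T *m invmx C *m (x - m)) 0 0 / 2).

(* X ~ N(m, C), for [C] symmetric positive definite *)
Definition is_gaussian n (X : {RV P >-> 'cV[R]_n}) (m : 'cV[R]_n)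
    (C : 'M[R]_n) : Prop :=
  is_density (@lebesgue_cV R n) (distribution P X) (gaussian_pdf m C).

Definition rv_entropy n (Z : {RV P >-> 'cV[R]_n}) : \bar R :=
  entropy (@lebesgue_cV R n) (distribution P Z).

(* Entropy of the law of (Z0, Z1) on R^m x R^n, whose Lebesgue measure is the
   product one. *)
Definition joint_entropy m n (Z0 : {RV P >-> 'cV[R]_m})
    (Z1 : {RV P >-> 'cV[R]_n}) : \bar R :=
  entropy (@lebesgue_cV R m \x @lebesgue_cV R n)%E
    (distribution P (rv_pair Z0 Z1)).

Definition mutual_information m n (Z0 : {RV P >-> 'cV[R]_m})
    (Z1 : {RV P >-> 'cV[R]_n}) : \bar R :=
  (rv_entropy Z0 + rv_entropy Z1 - joint_entropy Z0 Z1)%E.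

(* P(X | W = w) has density [f_{W,X}(w, x) / f_W(w)]. Conditional laws are
   in general only determined for almost every [w]; taking the continuous
   versions of [f_{W,X}] and [f_W], which are unique when they exist,
   determines them at every [w] such that [f_W(w) > 0]. *)
Definition conditional_pdf m n (W : {RV P >-> 'cV[R]_m})
    (X : {RV P >-> 'cV[R]_n}) (w : 'cV[R]_m) (x : 'cV[R]_n) : R :=
  density_in [set f : 'cV[R]_m * 'cV[R]_n -> R | continuous f]
    (@lebesgue_cV R m \x @lebesgue_cV R n)%E
    (distribution P (rv_pair W X)) (w, x) /
  density_in [set f : 'cV[R]_m -> R | continuous f]
    (@lebesgue_cV R m) (distribution P W) w.

Definition posterior m n (W : {RV P >-> 'cV[R]_m}) (X : {RV P >-> 'cV[R]_n})
    (w : 'cV[R]_m) : set 'cV[R]_n -> \bar R :=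
  fun A => (\int[@lebesgue_cV R n]_(x in A) (conditional_pdf W X w x)%:E)%E.

Section posterior_measure.
Context m n (W : {RV P >-> 'cV[R]_m}) (X : {RV P >-> 'cV[R]_n}).
Context (w : 'cV[R]_m).

Lemma conditional_pdf_ge0 x : 0 <= conditional_pdf W X w x.
Proof. by rewrite divr_ge0// density_in_ge0. Qed.

Lemma measurable_conditional_pdf :
  measurable_fun [set: 'cV[R]_n] (conditional_pdf W X w).
Proof.
apply: measurable_funM => //.
exact: measurableT_comp (density_in_measurable _ _ _) (pair1_measurable w).
Qed.

Let posterior0 : posterior W X w set0 = 0%E.
Proof. exact: integral_set0. Qed.

Let posterior_ge0 A : (0 <= posterior W X w A)%E.
Proof.
by apply: integral_ge0 => x _; rewrite lee_fin conditional_pdf_ge0.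
Qed.

Let posterior_sigma_additive : semi_sigma_additive (posterior W X w).
Proof.
move=> F mF tF mUF; rewrite /posterior ge0_integral_bigcup//=.
- by apply: is_cvg_ereal_nneg_natsum_cond => k _ _; exact: posterior_ge0.
- apply: measurable_funTS; apply/measurable_EFinP.
  exact: measurable_conditional_pdf.
- by move=> x _; rewrite lee_fin conditional_pdf_ge0.
Qed.

HB.instance Definition _ := isMeasure.Build _ _ _ (posterior W X w)
  posterior0 posterior_ge0 posterior_sigma_additive.

End posterior_measure.

End probability.

Section optimisation.
Context {U : Type} {R : realType}.
Implicit Types (D : set U) (f : U -> \bar R).

Definition is_maximizer D f u : Prop :=
  D u /\ forall v, D v -> (f v <= f u)%E.

Definition is_minimizer D f u : Prop :=
  D u /\ forall v, D v -> (f u <= f v)%E.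

Definition is_max D f (a : \bar R) : Prop :=
  exists2 u, is_maximizer D f u & f u = a.

End optimisation.

(* Main.v *)
(* Put A = V^T B and S = V^T C_E V, so that W = A X + F with F = V^T E of law
   N(V^T m_E, S) independent of X.  The pair (W, X) has the continuous density
   phi_X(x) phi_F(w - A x), and completing the square turns it into the density
   of W, with covariance T = A C_X A^T + S = V^T C_Y V, times the density in x
   of a Gaussian whose covariance Sigma does not depend on w and satisfies
   det Sigma det T = det C_X det S.  With the entropy
   (n/2) log(2 pi e) + (1/2) log det C of N(m, C), this gives both equalities.

   For the maximization, diagonalize C_Y and C_E simultaneously.  If mu_i are the
   eigenvalues of the pencil (V^T C_Y V, V^T C_E V), then det T / det S is the
   product of the mu_i, and mu_i <= lambda_i by Poincare separation; equality
   holds when the columns of V are dominant eigenvectors. *)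

Require Import Defs.
From HB Require Import structures.
From mathcomp Require Import all_boot all_order all_algebra.
From mathcomp Require Import all_classical all_reals all_analysis.
From mathcomp Require Import measurable_realfun ring lra spectral perm.
From mathcomp Require complex.

Set Implicit Arguments.
Unset Strict Implicit.
Unset Printing Implicit Defensive.

Import Order.TTheory GRing.Theory Num.Theory.
Import numFieldNormedType.Exports.

Local Open Scope classical_set_scope.
Local Open Scope ring_scope.


(** * Bilinear forms and positive definite matrices *)

(** On R^n, Lebesgue measure enters only through splitting off a coordinate, Tonelli and translation
    invariance; no linear change of variables is made. This shapes the Gaussian part: the
    normalising constant comes from eliminating one coordinate at a time by Schur complements, the
    mean of the quadratic form from comparing its dilations (absorbed into the matrix), and the law
    of V^T E from two translations. The posterior is fixed at every w by continuous versions of the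
    densities, so equality almost everywhere does not identify it. Continuous densities are shown to
    coincide everywhere, because every neighbourhood contains a measurable set of positive measure.
    Since H(W, X) = H(X) + H(F), the mutual information is H(W) - H(F), and the constants cancel
    because W and F have the same dimension r. *)

Section bilinear_form.
Context {R : comNzRingType}.

Definition bform m n (M : 'M[R]_(m, n)) (u : 'cV[R]_m) (v : 'cV[R]_n) : R :=
  (u^T *m M *m v) 0 0.

Lemma bformDl m n (M : 'M[R]_(m, n)) u1 u2 v :
  bform M (u1 + u2) v = bform M u1 v + bform M u2 v.
Proof. by rewrite /bform linearD /= !mulmxDl mxE. Qed.

Lemma bformDr m n (M : 'M[R]_(m, n)) u v1 v2 :
  bform M u (v1 + v2) = bform M u v1 + bform M u v2.
Proof. by rewrite /bform !mulmxDr mxE. Qed.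

Lemma bformNl m n (M : 'M[R]_(m, n)) u v : bform M (- u) v = - bform M u v.
Proof. by rewrite /bform linearN /= !mulNmx mxE. Qed.

Lemma bformNr m n (M : 'M[R]_(m, n)) u v : bform M u (- v) = - bform M u v.
Proof. by rewrite /bform !mulmxN mxE. Qed.

Lemma bformZl m n (M : 'M[R]_(m, n)) a u v :
  bform M (a *: u) v = a * bform M u v.
Proof. by rewrite /bform linearZ /= -!scalemxAl mxE. Qed.

Lemma bformZr m n (M : 'M[R]_(m, n)) a u v :
  bform M u (a *: v) = a * bform M u v.
Proof. by rewrite /bform -!scalemxAr mxE. Qed.

Lemma bformMl m n p (M : 'M[R]_(m, n)) (A : 'M[R]_(m, p)) u v :
  bform M (A *m u) v = bform (A^T *m M) u v.
Proof. by rewrite /bform trmx_mul !mulmxA. Qed.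

Lemma bformMr m n p (M : 'M[R]_(m, n)) (A : 'M[R]_(n, p)) u v :
  bform M u (A *m v) = bform (M *m A) u v.
Proof. by rewrite /bform !mulmxA. Qed.

Lemma bform_addmx m n (M N : 'M[R]_(m, n)) u v :
  bform (M + N) u v = bform M u v + bform N u v.
Proof. by rewrite /bform mulmxDr mulmxDl mxE. Qed.

Lemma bform_oppmx m n (M : 'M[R]_(m, n)) u v : bform (- M) u v = - bform M u v.
Proof. by rewrite /bform mulmxN mulNmx mxE. Qed.

Lemma bformC m n (M : 'M[R]_(m, n)) u v : bform M u v = bform M^T v u.
Proof.
transitivity ((u^T *m M *m v)^T 0 0); first by rewrite [RHS]mxE.
by rewrite !trmx_mul trmxK mulmxA.
Qed.

Lemma bform0r m n (M : 'M[R]_(m, n)) u : bform M u 0 = 0.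
Proof. by rewrite /bform mulmx0 mxE. Qed.

Lemma bform_sumE m n (M : 'M[R]_(m, n)) u v :
  bform M u v = \sum_i \sum_j u i 0 * M i j * v j 0.
Proof.
rewrite /bform -mulmxA mxE; apply: eq_bigr => i _.
rewrite !mxE mulr_sumr; apply: eq_bigr => j _.
by rewrite mulrA.
Qed.

Lemma bform_col m n p q (M : 'M[R]_(m, n)) (U : 'M[R]_(m, p)) (V : 'M[R]_(n, q)) i j :
  (U^T *m M *m V) i j = bform M (col i U) (col j V).
Proof.
rewrite /bform tr_col -row_mul mxE [RHS]mxE; apply: eq_bigr => k _.
by rewrite !mxE.
Qed.

(** Sylvester's identity. The two sides are determinants of block triangular matrices that are
    conjugate under a unipotent block matrix. *)
Lemma det_1addmulC m n (M : 'M[R]_(m, n)) (N : 'M[R]_(n, m)) :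
  \det (1%:M + M *m N) = \det (1%:M + N *m M).
Proof.
have E : block_mx 1%:M (- M) 0 1%:M *m block_mx (1%:M + M *m N) 0 N 1%:M =
    block_mx 1%:M 0 N (1%:M + N *m M) *m block_mx 1%:M (- M) 0 1%:M.
  rewrite !mulmx_block !mul0mx !mulmx0 !mul1mx !mulmx1 !addr0 !add0r.
  by rewrite mulNmx addrK mulmxN [1%:M + N *m M]addrC addKr.
have := congr1 (fun X => \det X) E.
by rewrite !det_mulmx !det_ublock !det_lblock !det1 !(mul1r, mulr1).
Qed.

End bilinear_form.

Section posdef.
Context {R : realType}.
Implicit Types (n r : nat).

Lemma spd_tr n (C : 'M[R]_n) : sym_posdef C -> C^T = C.
Proof. by case. Qed.

Lemma spd_gt0 n (C : 'M[R]_n) v : sym_posdef C -> v != 0 -> 0 < bform C v v.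
Proof. by case=> _; exact. Qed.

Lemma spd_ge0 n (C : 'M[R]_n) v : sym_posdef C -> 0 <= bform C v v.
Proof.
by move=> sC; have [->|/(spd_gt0 sC)/ltW//] := eqVneq v 0; rewrite bform0r.
Qed.

Lemma spd_unit n (C : 'M[R]_n) : sym_posdef C -> C \in unitmx.
Proof.
move=> [CT C0]; rewrite -row_free_unit -kermx_eq0.
apply/eqP/row_matrixP => i; rewrite row0; apply/eqP/negPn/negP => ri0.
have := C0 (row i (kermx C))^T; rewrite trmxK -row_mul mulmx_ker row0 mul0mx mxE ltxx.
by move=> /(_ _)/negP; rewrite -(inj_eq trmx_inj) trmxK trmx0 ri0 => /(_ isT).
Qed.

Lemma spd_congr n r (C : 'M[R]_n) (V : 'M[R]_(n, r)) : sym_posdef C ->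
  (forall x : 'cV[R]_r, V *m x = 0 -> x = 0) -> sym_posdef (V^T *m C *m V).
Proof.
move=> sC V_inj; split; first by rewrite !trmx_mul trmxK (spd_tr sC) mulmxA.
move=> v v0; rewrite -mulmxA mulmxA -/(bform _ _ _) -bformMr -bformMl.
apply: spd_gt0 => //; apply: contra_neq v0; exact: V_inj.
Qed.

Lemma spd_inv n (C : 'M[R]_n) : sym_posdef C -> sym_posdef (invmx C).
Proof.
move=> sC; have uC := spd_unit sC.
suff -> : invmx C = (invmx C)^T *m C *m invmx C.
  apply: spd_congr => // x /(congr1 (mulmx C)).
  by rewrite mulmxA mulmxV// mul1mx mulmx0.
by rewrite trmx_inv (spd_tr sC) mulVmx// mul1mx.
Qed.

Lemma spd_inv_tr n (C : 'M[R]_n) : sym_posdef C -> (invmx C)^T = invmx C.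
Proof. by move/spd_inv/spd_tr. Qed.

Lemma spd_addl n r (C : 'M[R]_n) (S : 'M[R]_r) (A : 'M[R]_(r, n)) :
  sym_posdef C -> sym_posdef S -> sym_posdef (A *m C *m A^T + S).
Proof.
move=> sC sS; split.
  by rewrite linearD /= !trmx_mul trmxK (spd_tr sC) (spd_tr sS) mulmxA.
move=> v v0; rewrite -/(bform _ _ _) bform_addmx ltr_wpDl ?(spd_gt0 sS)//.
have -> : A *m C *m A^T = A^T^T *m C *m A^T by rewrite trmxK.
by rewrite -mulmxA -bformMl -bformMr spd_ge0.
Qed.

Lemma full_col_rank_inj n r (V : 'M[R]_(n, r)) (x : 'cV[R]_r) :
  (r <= n)%N -> full_rank V -> V *m x = 0 -> x = 0.
Proof.
rewrite /full_rank => rn; rewrite (minn_idPr rn) => rkV Vx.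
apply: trmx_inj; rewrite trmx0; apply/eqP.
have fV : row_free V^T by rewrite /row_free mxrank_tr rkV.
by rewrite -(mulmx_free_eq0 _ fV) -trmx_mul Vx trmx0.
Qed.

End posdef.

(** * Generalized eigenvalues *)

Section complex_parts.
Import complex.
Context {R : realType}.
Local Notation toC := (map_mx (@complex.real_complex_def R (Phant R))).

Let ReD (x y : complex R) : complex.Re (x + y) = complex.Re x + complex.Re y.
Proof. by case: x y => ? ? []. Qed.

Let ImD (x y : complex R) : complex.Im (x + y) = complex.Im x + complex.Im y.
Proof. by case: x y => ? ? []. Qed.

Lemma map_Re_mulmx m n p (M : 'M[complex R]_(m, n)) (A : 'M[R]_(n, p)) :
  map_mx (@complex.Re R) (M *m toC A) = map_mx (@complex.Re R) M *m A.
Proof.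
apply/matrixP => i j; rewrite !mxE (big_morph _ ReD (erefl : complex.Re 0 = 0)).
by apply: eq_bigr => k _; rewrite !mxE; case: (M i k) => a b /=; rewrite mulr0 subr0.
Qed.

Lemma map_Im_mulmx m n p (M : 'M[complex R]_(m, n)) (A : 'M[R]_(n, p)) :
  map_mx (@complex.Im R) (M *m toC A) = map_mx (@complex.Im R) M *m A.
Proof.
apply/matrixP => i j; rewrite !mxE (big_morph _ ImD (erefl : complex.Im 0 = 0)).
by apply: eq_bigr => k _; rewrite !mxE; case: (M i k) => a b /=; rewrite mulr0 add0r.
Qed.

(* A complex eigenvalue of a symmetric pencil is real, so the real and the
   imaginary part of a complex eigenvector are both eigenvectors. *)
Lemma geigenvector_exists n (A C : 'M[R]_n.+1) : A^T = A -> sym_posdef C ->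
  exists l, exists2 v : 'cV[R]_n.+1, v != 0 & A *m v = l *: (C *m v).
Proof.
move=> AT sC; have CT := spd_tr sC.
have [a /eigenvalueP[v vA v0]] :=
  @eigenvalue_closed (complex R) n.+1 (toC (A *m invmx C)) isT.
have {}vA : v *m toC A = a *: (v *m toC C).
  rewrite scalemxAl -vA -mulmxA -map_mxM/= -mulmxA mulVmx ?mulmx1//.
  exact: spd_unit.
set u := (map_mx (@complex.Re R) v)^T; set w := (map_mx (@complex.Im R) v)^T.
have Au : A *m u = complex.Re a *: (C *m u) - complex.Im a *: (C *m w).
  apply: trmx_inj; rewrite linearB !linearZ /= !trmx_mul AT CT !trmxK.
  rewrite -!map_Re_mulmx -map_Im_mulmx vA; move: (v *m toC C) => M.
  by apply/matrixP => i j; rewrite !mxE; case: (a) (M i j) => ? ? [? ?]; rewrite /= ?mulrN.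
have Aw : A *m w = complex.Re a *: (C *m w) + complex.Im a *: (C *m u).
  apply: trmx_inj; rewrite linearD !linearZ /= !trmx_mul AT CT !trmxK.
  rewrite -!map_Im_mulmx -map_Re_mulmx vA; move: (v *m toC C) => M.
  by apply/matrixP => i j; rewrite !mxE; case: (a) (M i j) => ? ? [? ?]; rewrite /= ?mulrN.
have uw : u != 0 \/ w != 0.
  apply/orP; rewrite -negb_and; apply: contra v0 => /andP[/eqP u0 /eqP w0].
  apply/eqP/matrixP => i j; have := congr1 (fun X : 'cV[R]__ => X j i) u0.
  have := congr1 (fun X : 'cV[R]__ => X j i) w0; rewrite !mxE.
  by case: (v i j) => ? ? /= -> ->.
(* Computing u^T A w from both sides, by symmetry of A, leaves Im a (w^T C w + u^T C u) = 0, and the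
   second factor is positive. *)
have Ima0 : complex.Im a = 0.
  have : bform 1%:M (A *m u) w = bform 1%:M u (A *m w).
    by rewrite bformMl bformMr mulmx1 mul1mx AT.
  rewrite Au Aw bformDl bformDr bformNl !bformZl !bformZr !bformMl !bformMr.
  rewrite CT mulmx1 mul1mx => /eqP; rewrite -subr_eq0.
  rewrite opprD addrAC addrA subrr sub0r -opprD oppr_eq0 -mulrDr mulf_eq0.
  case/orP => [/eqP//|]; rewrite paddr_eq0 ?spd_ge0// => /andP[/eqP ww0 /eqP uu0].
  by case: uw => /(spd_gt0 sC); rewrite ?ww0 ?uu0 ltxx.
move: Au Aw; rewrite Ima0 !scale0r subr0 addr0 => Au Aw.
by exists (complex.Re a); case: uw => ?; [exists u|exists w].
Qed.

End complex_parts.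

(** * Simultaneous diagonalisation of a symmetric pencil *)

Section simultaneous_diagonalisation.
Context {R : realType}.

(** Provides a complement: with w = C v, the last n rows of Q are independent and C-orthogonal to
    v. *)
Lemma unitmx_col_reduce n (w : 'cV[R]_(1 + n)) :
  exists2 Q : 'M[R]_(1 + n), Q \in unitmx & dsubmx Q *m w = 0.
Proof.
exists (invmx (col_ebase w)); first by rewrite unitmx_inv col_ebase_unit.
rewrite mul_dsub_mx -[X in _ *m X](mulmx_ebase w) 2!mulmxA.
rewrite mulVmx ?col_ebase_unit// mul1mx -mul_dsub_mx.
suff -> : dsubmx (pid_mx (\rank w) : 'M[R]_(1 + n, 1)) = 0 by rewrite mul0mx.
by apply/matrixP => i j; rewrite !mxE ord1.
Qed.

(** Induction splitting off one eigenvector v normalised by C. Its C-orthogonal complement is also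
    A-orthogonal to v, because A v = l C v, so both forms become block diagonal. *)
Lemma simdiag_exists n (A C : 'M[R]_n) : A^T = A -> sym_posdef C ->
  exists (G : 'M[R]_n) (d : 'rV[R]_n),
    G^T *m C *m G = 1%:M /\ G^T *m A *m G = diag_mx d.
Proof.
elim: n A C => [|n IHn] A C AT sC.
  by exists 0, 0; split; rewrite [LHS]flatmx0 [RHS]flatmx0.
have [l [v v0 Av]] := geigenvector_exists AT sC.
wlog v1 : v v0 Av / bform C v v = 1.
  move=> H; have vv := spd_gt0 sC v0.
  have s0 : Num.sqrt (bform C v v) != 0 by rewrite gt_eqF// sqrtr_gt0.
  apply: (H ((Num.sqrt (bform C v v))^-1 *: v)).
  - by rewrite scaler_eq0 invr_eq0 negb_or s0.
  - by rewrite -!scalemxAr Av !scalerA mulrC.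
  - by rewrite bformZl bformZr mulrA -invfM -expr2 sqr_sqrtr ?ltW// mulVf// gt_eqF.
have [Q uQ Qv] := @unitmx_col_reduce n (C *m v).
(* The columns of [N] are a basis of the C-orthogonal complement of v. *)
set N := (dsubmx Q)^T.
have N_inj (x : 'cV[R]_n) : N *m x = 0 -> x = 0.
  move=> /(congr1 trmx); rewrite trmx_mul trmx0 trmxK => xQ.
  have : row_mx (0 : 'rV_1) x^T *m Q = 0.
    by rewrite -[Q in X in X = _]vsubmxK mul_row_col mul0mx add0r.
  move/(congr1 (mulmx^~ (invmx Q))); rewrite mul0mx -mulmxA mulmxV// mulmx1.
  by move/(congr1 rsubmx); rewrite row_mxKr linear0 => /(congr1 trmx); rewrite trmxK trmx0.
have [//||H [d [HC HA]]] := IHn (N^T *m A *m N) (N^T *m C *m N).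
- by rewrite !trmx_mul trmxK AT mulmxA.
- exact: spd_congr.
have NCv : N^T *m (C *m v) = 0 by rewrite trmxK.
clearbody N.
have vCN : v^T *m C *m N = 0.
  by apply: trmx_inj; rewrite !trmx_mul trmx0 trmxK (spd_tr sC).
have vAv : v^T *m A *m v = l%:M.
  apply/matrixP => i j; rewrite !ord1 -mulmxA Av -scalemxAr mulmxA mxE.
  by rewrite -/(bform _ _ _) v1 mxE mulr1.
have blockE (M : 'M[R]_n.+1) :
    (row_mx v (N *m H))^T *m M *m row_mx v (N *m H) =
    block_mx (v^T *m M *m v) (v^T *m M *m N *m H)
      (H^T *m (N^T *m (M *m v))) (H^T *m (N^T *m M *m N) *m H).
  by rewrite tr_row_mx mul_col_mx mul_col_row trmx_mul !mulmxA.
exists (row_mx v (N *m H)), (row_mx l%:M d); split; rewrite blockE.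
- rewrite NCv mulmx0 vCN mul0mx HC.
  suff -> : v^T *m C *m v = 1%:M by rewrite -scalar_mx_block.
  by apply/matrixP => i j; rewrite !ord1 -/(bform _ _ _) v1 mxE.
- have NAv : N^T *m (A *m v) = 0 by rewrite Av -scalemxAr NCv scaler0.
  have vAN : v^T *m A *m N = 0.
    by apply: trmx_inj; rewrite !trmx_mul trmx0 trmxK AT.
  rewrite NAv mulmx0 vAN mul0mx HA vAv; apply: (etrans _ (esym (@diag_mx_row R n 1 l%:M d))).
  suff -> : diag_mx l%:M = l%:M :> 'M[R]_1 by [].
  by apply/matrixP => i j; rewrite !ord1 !mxE.
Qed.

End simultaneous_diagonalisation.

(** * Schur complements and completion of squares *)

Section quadratic_forms.
Context {R : realType}.

(** Diagonalising C against itself gives G^T C G = 1, hence (det G)^2 det C = 1. *)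
Lemma spd_det_gt0 n (C : 'M[R]_n) : sym_posdef C -> 0 < \det C.
Proof.
move=> sC; have [G [_ [GC _]]] := simdiag_exists (spd_tr sC) sC.
have := congr1 (fun X => \det X) GC; rewrite !det_mulmx det_tr det1 mulrAC -expr2 => d1.
have : 0 < \det G ^+ 2 * \det C by rewrite d1.
rewrite pmulr_rgt0// lt_neqAle sqr_ge0 andbT eq_sym; apply/eqP => G0.
by move: d1; rewrite G0 mul0r => /esym/eqP; rewrite oner_eq0.
Qed.

Section schur_complement.
Context n (P : 'M[R]_(1 + n)).
Let p := P 0 0.
Let b : 'rV[R]_n := ursubmx P.

(** The pivot is a single entry, to match [lebesgue_cV]: integrating the first coordinate out of
    exp(-P/2) leaves the quadratic form of this matrix. *)
Definition schur_compl : 'M[R]_n := drsubmx P - p^-1 *: (b^T *m b).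

Hypothesis sP : sym_posdef P.

Let PE : P = block_mx p%:M b b^T (drsubmx P).
Proof.
rewrite -[LHS]submxK; congr block_mx.
  by apply/matrixP => i j; rewrite !ord1 !mxE; congr (P _ _); apply/val_inj.
by rewrite trmx_ursub (spd_tr sP).
Qed.

Lemma schur_pivot_gt0 : 0 < p.
Proof.
have -> : p = bform P (col 0 1%:M) (col 0 1%:M).
  by rewrite -bform_col trmx1 mul1mx mulmx1.
apply: spd_gt0 => //; apply/eqP => /matrixP/(_ 0 0)/eqP.
by rewrite !mxE/= oner_eq0.
Qed.

Lemma det_schur : \det P = p * \det schur_compl.
Proof.
have {1}-> : P = block_mx 1%:M 0 (p^-1 *: b^T) 1%:M *m block_mx p%:M b 0 schur_compl.
  rewrite mulmx_block !mul0mx !mul1mx !addr0 -!scalemxAl mul_mx_scalar.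
  by rewrite scalerA mulVf ?scale1r ?gt_eqF ?schur_pivot_gt0// addrC subrK -PE.
by rewrite det_mulmx det_lblock det_ublock !det1 !mul1r det_scalar.
Qed.

Lemma bform_schur (x : 'cV[R]_1) (y : 'cV[R]_n) :
  bform P (col_mx x y) (col_mx x y) =
  p * (x 0 0 + p^-1 * (b *m y) 0 0) ^+ 2 + bform schur_compl y y.
Proof.
have xE (x' : 'cV[R]_1) v : bform b x' v = x' 0 0 * (b *m v) 0 0.
  by rewrite /bform -mulmxA mxE big_ord1 mxE.
have -> : bform P (col_mx x y) (col_mx x y) =
    p * x 0 0 ^+ 2 + x 0 0 * (b *m y) 0 0 *+ 2 + bform (drsubmx P) y y.
  rewrite {1}PE /bform tr_col_mx mul_row_block mul_row_col !mulmxDl.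
  have addE (X Y : 'M[R]_1) : (X + Y) 0 0 = X 0 0 + Y 0 0 by rewrite mxE.
  rewrite !addE -/(bform b _ _) -/(bform b^T _ _) -/(bform (drsubmx P) _ _).
  rewrite (bformC b^T) trmxK !xE mul_mx_scalar -scalemxAl !mxE big_ord1 !mxE.
  by ring.
rewrite /schur_compl bform_addmx bform_oppmx.
have -> : bform (p^-1 *: (b^T *m b)) y y = p^-1 * (b *m y) 0 0 ^+ 2.
  by rewrite expr2 -xE bformMl /bform -scalemxAr -scalemxAl mxE.
by field; rewrite gt_eqF ?schur_pivot_gt0.
Qed.

Lemma spd_schur : sym_posdef schur_compl.
Proof.
split.
  rewrite linearB linearZ /= trmx_mul trmxK trmx_drsub (spd_tr sP).
  by [].
(* This first coordinate makes the square in [bform_schur] vanish. *)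
move=> y y0; have := @spd_gt0 _ _ _ (col_mx (- p^-1 *: (b *m y)) y) sP.
rewrite bform_schur -/(bform _ _ _) !mxE mulNr addNr expr0n mulr0 add0r; apply.
by apply: contra y0; rewrite col_mx_eq0 => /andP[].
Qed.

End schur_complement.

(** Here u = x - m_X and z is the centred observation; [M] is the posterior precision and [K] the
    gain. The cross terms match by M K = A^T S^-1, the terms in z by K^T M K = S^-1 - T^-1. *)
Lemma complete_square_posterior q r (CX : 'M[R]_q) (S : 'M[R]_r) (A : 'M[R]_(r, q)) :
  sym_posdef CX -> sym_posdef S ->
  let T := A *m CX *m A^T + S in
  let M := invmx CX + A^T *m invmx S *m A in
  let K := CX *m A^T *m invmx T in
  forall u z,
  bform (invmx CX) u u + bform (invmx S) (z - A *m u) (z - A *m u) =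
  bform (invmx T) z z + bform M (u - K *m z) (u - K *m z).
Proof.
move=> sX sS T M K u z.
have sT : sym_posdef T by exact: spd_addl.
have uX := spd_unit sX; have uS := spd_unit sS; have uT := spd_unit sT.
have MT : M^T = M.
  by rewrite linearD /= !trmx_mul trmxK (spd_inv_tr sX) (spd_inv_tr sS) mulmxA.
have MK : M *m K = A^T *m invmx S.
  have ->: M *m K = (A^T *m invmx S *m T) *m invmx T.
    rewrite /K !mulmxA; congr (_ *m _); rewrite /T mulmxDr mulmxKV//.
    by rewrite /M !mulmxDl mulVmx// mul1mx addrC !mulmxA.
  by rewrite mulmxK.
have KTMK : K^T *m M *m K = invmx S - invmx T.
  rewrite -mulmxA MK /K !trmx_mul trmxK (spd_inv_tr sT) (spd_tr sX) !mulmxA.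
  rewrite -(mulmxA _ A) -(mulmxA _ (A *m CX)) (_ : A *m CX *m A^T = T - S); last first.
    by rewrite /T addrK.
  by rewrite mulmxBr mulmxBl mulVmx// mul1mx -mulmxA mulmxV// mulmx1.
have -> : bform M (u - K *m z) (u - K *m z) =
    bform M u u - 2 * bform (A^T *m invmx S) u z + bform (invmx S - invmx T) z z.
  rewrite bformDl !bformDr !bformNl !bformNr opprK.
  rewrite (bformC _ (K *m z) u) MT bformMr MK bformMl bformMr KTMK.
  by ring.
have -> : bform M u u = bform (invmx CX) u u + bform (invmx S) (A *m u) (A *m u).
  by rewrite bform_addmx bformMl bformMr.
rewrite bformDl !bformDr !bformNl !bformNr opprK bform_addmx bform_oppmx.
rewrite (bformC _ z (A *m u)) (spd_inv_tr sS) [bform _ (A *m u) z]bformMl.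
by ring.
Qed.

Lemma complete_square_image n r (C : 'M[R]_n) (A : 'M[R]_(r, n)) :
  sym_posdef C -> sym_posdef (A *m C *m A^T) ->
  let S := A *m C *m A^T in
  let K := C *m A^T *m invmx S in
  forall x w,
  bform (invmx C) (x + K *m (w - A *m x)) (x + K *m (w - A *m x)) +
    bform (invmx S) (w - A *m x) (w - A *m x) =
  bform (invmx C) (x - K *m w) (x - K *m w) + bform (invmx S) w w.
Proof.
move=> sC sS S K x w.
have uC := spd_unit sC; have uS := spd_unit sS.
have PK : invmx C *m K = A^T *m invmx S by rewrite /K !mulmxA mulVmx// mul1mx.
have KPK : K^T *m invmx C *m K = invmx S.
  rewrite -mulmxA PK /K !trmx_mul trmxK (spd_inv_tr sS) (spd_tr sC) !mulmxA.
  by rewrite -(mulmxA _ A) -(mulmxA _ (A *m C)) mulVmx// mul1mx.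
have E z : bform (invmx C) (x + K *m z) (x + K *m z) =
    bform (invmx C) x x + 2 * bform (invmx S) (A *m x) z + bform (invmx S) z z.
  rewrite bformDl !bformDr (bformC _ (K *m z) x) (spd_inv_tr sC).
  rewrite bformMr PK bformMl bformMr KPK [bform (invmx S) (A *m x) z]bformMl.
  by ring.
rewrite -(mulmxN K) !E bformDl !bformDr !bformNl !bformNr opprK.
rewrite (bformC _ w (A *m x)) (spd_inv_tr sS).
by ring.
Qed.

End quadratic_forms.

Section posterior_precision.
Context {R : realType} q r (CX : 'M[R]_q) (S : 'M[R]_r) (A : 'M[R]_(r, q)).
Hypotheses (sX : sym_posdef CX) (sS : sym_posdef S).

Lemma spd_posterior_precision : sym_posdef (invmx CX + A^T *m invmx S *m A).
Proof.
have := spd_addl A^T (spd_inv sS) (spd_inv sX).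
by rewrite trmxK addrC.
Qed.

(** Factor S out of the right-hand side, swap the two factors by [det_1addmulC], then factor C_X
    out. *)
Lemma det_posterior_precision :
  \det (invmx CX + A^T *m invmx S *m A) * \det CX * \det S =
  \det (A *m CX *m A^T + S).
Proof.
have uX := spd_unit sX; have uS := spd_unit sS.
have -> : A *m CX *m A^T + S =
    S *m (1%:M + (invmx S *m A) *m (CX *m A^T)).
  by rewrite mulmxDr mulmx1 addrC !mulmxA mulmxV// mul1mx.
rewrite det_mulmx det_1addmulC mulrC; congr (_ * _).
have -> : 1%:M + CX *m A^T *m (invmx S *m A) =
    CX *m (invmx CX + A^T *m invmx S *m A).
  by rewrite mulmxDr mulmxV// !mulmxA.
by rewrite det_mulmx mulrC.
Qed.

End posterior_precision.

(** * Separation of eigenvalues *)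

Section generalized_eigenvalues.
Context {R : realType}.

Lemma rank_diag_mx n (e : 'rV[R]_n) :
  (\rank (diag_mx e) + \sum_(i < n) (e ord0 i == 0%R))%N = n.
Proof.
elim: n e => [|n IHn] e; first by rewrite big_ord0 [diag_mx e]flatmx0 mxrank0.
rewrite -[e](@hsubmxK _ 1 1 n); move: (lsubmx _) (rsubmx _) => e1 e2.
have rk : \rank (diag_mx (row_mx e1 e2)) = (\rank (diag_mx e1) + \rank (diag_mx e2))%N.
  by rewrite diag_mx_row rank_diag_block_mx.
rewrite [\rank _]rk big_ord_recl rank_rV.
have -> : (diag_mx e1 == 0) = (row_mx e1 e2 0 0 == 0).
  rewrite (_ : 0 = lshift n 0 :> 'I_(1 + n)) ?row_mxEl; last exact/val_inj.
  apply/eqP/eqP => [/matrixP/(_ 0 0)|e10]; first by rewrite !mxE eqxx.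
  by apply/matrixP => i j; rewrite !ord1 !mxE eqxx e10.
rewrite (eq_bigr (fun i => e2 0 i == 0 : nat)) => [|i _]; last first.
  congr (nat_of_bool (_ == _)); rewrite -[RHS](row_mxEr e1 e2).
  by congr (row_mx _ _ _ _); apply/val_inj.
by rewrite addnACA IHn; case: eqP.
Qed.

(** Congruence by the invertible G preserves the rank and turns A - l C into diag(d - l). *)
Lemma geigen_mult_diag n (A C G : 'M[R]_n) d l :
  G^T *m C *m G = 1%:M -> G^T *m A *m G = diag_mx d ->
  geigen_mult A C l = (\sum_(i < n) (d ord0 i == l))%N.
Proof.
move=> GC GA; have [uGC uG] := mulmx1_unit GC.
have E : G^T *m (A - l *: C) *m G = diag_mx (d - const_mx l).
  rewrite mulmxBr mulmxBl GA -scalemxAr -scalemxAl GC; apply/matrixP => i j.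
  by rewrite !mxE mulr_natr -mulrnBl.
rewrite /geigen_mult mxrank_ker mxrank_tr.
rewrite (_ : \rank (A - l *: C) = \rank (diag_mx (d - const_mx l))); last first.
  rewrite -E mxrankMfree ?row_free_unit// -[RHS]mxrank_tr trmx_mul trmxK.
  by rewrite mxrankMfree ?row_free_unit// mxrank_tr.
apply/eqP; rewrite -(eqn_add2l (\rank (diag_mx (d - const_mx l)))) subnKC ?rank_leq_row//.
rewrite -[X in X == _](rank_diag_mx (d - const_mx l)) eqn_add2l; apply/eqP.
by apply: eq_bigr => i _; rewrite !mxE subr_eq0.
Qed.

Lemma count_mem_tuple (T : eqType) n (t : n.-tuple T) x :
  count_mem x t = (\sum_(i < n) (tnth t i == x))%N.
Proof. by rewrite -sum1_count big_tuple big_mkcond; apply: eq_bigr => i _ /=; case: (_ == _). Qed.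

(** Any simultaneous diagonalisation has a diagonal with the multiplicities of [lam], hence a
    rearrangement of it; permuting the columns of G puts it in the order of [lam]. *)
Lemma geigenvalues_simdiag n (A C : 'M[R]_n) (lam : n.-tuple R) :
  A^T = A -> sym_posdef C -> geigenvalues A C lam ->
  exists2 G, G^T *m C *m G = 1%:M &
    G^T *m A *m G = diag_mx (\row_i tnth lam i).
Proof.
move=> AT sC [_ lamE]; have [G [d [GC GA]]] := simdiag_exists AT sC.
have /tuple_permP[s lams] : perm_eq lam [tuple d 0 i | i < n].
  apply/allP => x _; apply/eqP; apply: (etrans (lamE x)).
  rewrite (geigen_mult_diag _ GC GA); apply/esym/(etrans (count_mem_tuple _ _)).
  by apply: eq_bigr => i _; rewrite tnth_mktuple.
have lamsE i : tnth lam i = d 0 (s i).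
  have -> : lam = [tuple tnth [tuple d 0 i | i < n] (s i)  | i < n] by apply/val_inj.
  by rewrite !tnth_mktuple.
have E (M : 'M[R]_n) : (col_perm s G)^T *m M *m col_perm s G =
    row_perm s (col_perm s (G^T *m M *m G)).
  by rewrite tr_col_perm !col_permE !row_permE !mulmxA.
exists (col_perm s G); rewrite E ?GC ?GA; apply/matrixP => i j; rewrite !mxE.
  by rewrite (inj_eq perm_inj).
by rewrite (inj_eq perm_inj) lamsE.
Qed.

Lemma geigenvalues_exists n (A C : 'M[R]_n) : A^T = A -> sym_posdef C ->
  exists lam : n.-tuple R, geigenvalues A C lam.
Proof.
move=> AT sC; have [G [d [GC GA]]] := simdiag_exists AT sC.
exists [tuple of sort >=%R [tuple d 0 i | i < n]]; split.
  by apply: sort_sorted => x y; exact: le_total.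
move=> l; rewrite (geigen_mult_diag _ GC GA).
have /seq.permP -> : perm_eq (sort >=%R [tuple d 0 i | i < n]) [tuple d 0 i | i < n].
  by rewrite perm_sort.
by rewrite (@count_mem_tuple R n); apply: eq_bigr => i _; rewrite tnth_mktuple.
Qed.

Lemma bform_diag n (d : 'rV[R]_n) (x : 'cV[R]_n) :
  bform (diag_mx d) x x = \sum_i d 0 i * x i 0 ^+ 2.
Proof.
rewrite /bform mul_mx_diag mxE; apply: eq_bigr => i _; rewrite !mxE; ring.
Qed.

Lemma sorted_tnth n (lam : n.-tuple R) (i j : 'I_n) :
  sorted >=%R lam -> (i <= j)%N -> tnth lam j <= tnth lam i.
Proof.
move=> lams ij; rewrite !(tnth_nth 0).
by apply: (sorted_leq_nth ge_trans ge_refl 0 lams); rewrite ?inE ?size_tuple.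
Qed.

(* The test vector for index i in the Poincare separation below: M has i + 1
   columns to combine and only i rows to kill. *)
Lemma exists_flag_vector n r (rn : (r <= n)%N) (M : 'M[R]_(n, r)) (i : 'I_r) :
  exists2 c : 'cV[R]_r, c != 0 &
    (forall j : 'I_r, (i < j)%N -> c j 0 = 0) /\
    (forall k : 'I_n, (k < i)%N -> (M *m c) k 0 = 0).
Proof.
pose wk (k : 'I_i) : 'I_n := widen_ord rn (widen_ord (ltnW (ltn_ord i)) k).
pose L : 'M[R]_(r, i + (r - i.+1)) :=
  row_mx (\matrix_(j, k) M (wk k) j) (\matrix_(j, k) (j == i.+1 + k :> nat)%:R).
have : kermx L != 0.
  rewrite kermx_eq0 /row_free neq_ltn (leq_ltn_trans (rank_leq_col _))//.
  by rewrite -[X in (_ < X)%N](subnKC (ltn_ord i)) addSn.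
move=> /rowV0Pn[c /sub_kermxP]; rewrite mul_mx_row -row_mx0 => /eq_row_mx[c1 c2] c0.
exists c^T; first by rewrite -(inj_eq trmx_inj) trmxK trmx0.
split=> [j ij|k ki].
  have kr : (j - i.+1 < r - i.+1)%N by rewrite ltn_sub2r ?(leq_ltn_trans ij).
  have := congr1 (fun X : 'rV_ _ => X 0 (Ordinal kr)) c2.
  have kj (j' : 'I_r) : (j' == i.+1 + Ordinal kr :> nat) = (j' == j).
    exact: (congr1 (fun z => val j' == z) (subnKC ij)).
  rewrite !mxE (bigD1 j isT) big1 => [|j' /negbTE j'j]; rewrite !mxE kj.
    by rewrite eqxx mulr1 /= addr0.
  by rewrite j'j mulr0.
have := congr1 (fun X : 'rV_ _ => X 0 (Ordinal ki)) c1.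
rewrite !mxE => E; apply: etrans E; apply: eq_bigr => j _; rewrite !mxE mulrC; congr (_ * M _ _).
exact/val_inj.
Qed.

(** For the vector c of [exists_flag_vector], mu_i |c|^2 <= c^T diag(mu) c = (M c)^T diag(lam) (M c)
    <= lam_i |M c|^2 = lam_i |c|^2. The first inequality uses that c lives on indices up to i, the
    second that M c lives on indices from i on. *)
Lemma poincare_separation n r (rn : (r <= n)%N) (M : 'M[R]_(n, r))
    (lam : n.-tuple R) (mu : r.-tuple R) :
  sorted >=%R lam -> sorted >=%R mu -> M^T *m M = 1%:M ->
  M^T *m diag_mx (\row_i tnth lam i) *m M = diag_mx (\row_i tnth mu i) ->
  forall i : 'I_r, tnth mu i <= tnth lam (widen_ord rn i).
Proof.
move=> lams mus M1 Mmu i; have [c c0 [cgt Mclt]] := exists_flag_vector rn M i.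
have normE m (x : 'cV[R]_m) : bform 1%:M x x = \sum_j x j 0 ^+ 2.
  by rewrite /bform mulmx1 mxE; apply: eq_bigr => j _; rewrite mxE expr2.
have ccE : bform 1%:M (M *m c) (M *m c) = bform 1%:M c c.
  by rewrite bformMl bformMr mulmx1 M1.
have cc : 0 < bform 1%:M c c.
  rewrite lt_neqAle normE sumr_ge0 ?andbT => [|? _]; last exact: sqr_ge0.
  rewrite eq_sym; apply: contra c0 => /eqP/psumr_eq0P E; apply/eqP/matrixP => j k.
  by rewrite ord1 mxE; apply/eqP; rewrite -sqrf_eq0 E// => ? _; exact: sqr_ge0.
rewrite -(ler_pM2r cc).
apply: (@le_trans _ _ (bform (diag_mx (\row_i tnth mu i)) c c)).
  rewrite bform_diag normE mulr_sumr; apply: ler_sum => j _; rewrite mxE.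
  case: (leqP j i) => ji; last by rewrite cgt// expr0n !mulr0.
  by rewrite ler_wpM2r ?sqr_ge0// sorted_tnth.
rewrite -Mmu -bformMr -bformMl -ccE bform_diag normE mulr_sumr.
apply: ler_sum => k _; rewrite mxE.
case: (leqP i k) => ki; last by rewrite Mclt// expr0n !mulr0.
by rewrite ler_wpM2r ?sqr_ge0// sorted_tnth.
Qed.

End generalized_eigenvalues.

(** * Determinants of a pencil compressed to r dimensions *)

Section rayleigh_determinant.
Context {R : realType} (n r : nat) (A C : 'M[R]_n) (lam : n.-tuple R).
Hypotheses (sA : sym_posdef A) (sC : sym_posdef C) (rn : (r <= n)%N).
Hypothesis lamE : geigenvalues A C lam.

(** lam_i is the value of the form A at the i-th column of G, which is nonzero. The bound on i keeps
    the default value 0 of the list access out. *)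
Lemma geigenvalue_gt0 i : (i < n)%N -> 0 < lam`_i.
Proof.
move=> ni; have [G GC GA] := geigenvalues_simdiag (spd_tr sA) sC lamE.
have [_ uG] := mulmx1_unit GC.
have := congr1 (fun X : 'M[R]_n => X (Ordinal ni) (Ordinal ni)) GA.
rewrite bform_col !mxE eqxx mulr1n (tnth_nth 0) /= => <-.
apply: spd_gt0 => //; rewrite colE; apply/eqP => /(congr1 (mulmx (invmx G))).
rewrite mulmxA mulVmx// mul1mx mulmx0 => /matrixP/(_ (Ordinal ni) 0)/eqP.
by rewrite !mxE !eqxx oner_eq0.
Qed.

Lemma det_congr_le (V : 'M[R]_(n, r)) : full_rank V ->
  \det (V^T *m A *m V) <= \prod_(i < r) lam`_i * \det (V^T *m C *m V).
Proof.
move=> Vr; have V_inj x := @full_col_rank_inj _ n r V x rn Vr.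
have sA2 : sym_posdef (V^T *m A *m V) by exact: spd_congr.
have sC2 : sym_posdef (V^T *m C *m V) by exact: spd_congr.
have [G GC GA] := geigenvalues_simdiag (spd_tr sA) sC lamE.
have [mu muE] := geigenvalues_exists (spd_tr sA2) sC2.
have [H HC HA] := geigenvalues_simdiag (spd_tr sA2) sC2 muE.
have [_ uG] := mulmx1_unit GC; have [_ uH] := mulmx1_unit HC.
(* [M] holds the coordinates of the eigenvectors V H of the compressed pencil in the C-orthonormal
   basis G; its columns are therefore orthonormal. *)
pose M := invmx G *m V *m H.
have GM : G *m M = V *m H by rewrite /M !mulmxA mulmxV// mul1mx.
clearbody M.
have E N : M^T *m (G^T *m N *m G) *m M = H^T *m (V^T *m N *m V) *m H.
  transitivity ((G *m M)^T *m N *m (G *m M)); first by rewrite trmx_mul !mulmxA.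
  by rewrite GM trmx_mul !mulmxA.
have mu_le := @poincare_separation _ _ _ rn M lam mu lamE.1 muE.1.
have detE N : \det (H^T *m N *m H) = \det H ^+ 2 * \det N.
  by rewrite !det_mulmx det_tr; ring.
have dH : 0 < \det H ^+ 2 by rewrite exprn_even_gt0//= -unitfE -unitmxE.
rewrite -(ler_pM2l dH) -detE HA det_diag mulrCA -detE HC det1 mulr1.
(* Comparing the products factor by factor requires nonnegative smaller factors. *)
have mu_gt0 i : 0 < tnth mu i.
  have := congr1 (fun X : 'M[R]_r => X i i) HA; rewrite bform_col !mxE eqxx mulr1n => <-.
  apply: spd_gt0 => //; rewrite colE; apply/eqP => /(congr1 (mulmx (invmx H))).
  rewrite mulmxA mulVmx// mul1mx mulmx0 => /matrixP/(_ i 0)/eqP.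
  by rewrite !mxE !eqxx oner_eq0.
apply: ler_prod => i _; rewrite mxE ltW//=.
rewrite (le_trans (mu_le _ _ i))//; last by rewrite (tnth_nth 0).
  by rewrite -[M^T]mulmx1 -GC E HC.
by rewrite -GA E HA.
Qed.

(** The eigenvector equations together read A V = C V diag(lambda); multiply by V^T and take
    determinants. *)
Lemma det_congr_dominant (V : 'M[R]_(n, r)) :
  (forall i : 'I_r, A *m col i V = lam`_i *: (C *m col i V)) ->
  \det (V^T *m A *m V) = \prod_(i < r) lam`_i * \det (V^T *m C *m V).
Proof.
move=> VE; have AV : A *m V = C *m V *m diag_mx (\row_(i < r) lam`_i).
  rewrite mul_mx_diag; apply/matrixP => i j.
  have := congr1 (fun X : 'cV[R]_n => X i 0) (VE j).
  by rewrite !colE !mulmxA -!colE !mxE mulrC.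
rewrite -mulmxA AV !mulmxA det_mulmx det_diag mulrC; congr (_ * _).
by apply: eq_bigr => i _; rewrite mxE.
Qed.

Lemma dominant_eigenvectors_exist : exists V : 'M[R]_(n, r), full_rank V /\
  forall i : 'I_r, A *m col i V = lam`_i *: (C *m col i V).
Proof.
have [G GC GA] := geigenvalues_simdiag (spd_tr sA) sC lamE.
have [uGC uG] := mulmx1_unit GC.
(* The first r columns of G, which belong to the largest eigenvalues since [lam] is sorted. *)
exists (G *m pid_mx r); split.
  rewrite /full_rank (minn_idPr rn) -mxrank_tr trmx_mul.
  by rewrite mxrankMfree ?row_free_unit ?unitmx_tr// mxrank_tr rank_pid_mx.
move=> i; apply: (can_inj (mulKmx (_ : G^T \in unitmx))); first by rewrite unitmx_tr.
have cE : col i (pid_mx r : 'M[R]_(n, r)) = delta_mx (widen_ord rn i) 0.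
  apply/matrixP => k l; rewrite !mxE ord1 eqxx andbT -val_eqE/=.
  by case: eqP => //= ->; rewrite ltn_ord.
rewrite -scalemxAr !(colE i) -!mulmxA -!colE cE !mulmxA GA GC mul1mx -colE.
apply/matrixP => k l; rewrite !mxE ord1 eqxx andbT (tnth_nth 0) /=.
by case: eqP => [->|_]; rewrite ?mulr1n ?mulr1 ?mulr0n ?mulr0.
Qed.

End rayleigh_determinant.

(** * Lebesgue measure on column vectors *)

Section measurable_vectors.
Context d (T : measurableType d) (R : realType).

Lemma measurable_mx_mulr m n p (A : 'M[R]_(m, n)) (u : T -> 'M[R]_(n, p)) :
  measurable_fun [set: T] u -> measurable_fun [set: T] (fun t => A *m u t).
Proof.
move=> /measurable_fun_mxP mu; apply/measurable_fun_mxP => i j.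
under eq_fun do rewrite mxE.
by apply: measurable_sum => k; apply: measurable_funM.
Qed.

Lemma measurable_mxD m n (u v : T -> 'M[R]_(m, n)) :
  measurable_fun [set: T] u -> measurable_fun [set: T] v ->
  measurable_fun [set: T] (fun t => u t + v t).
Proof.
move=> /measurable_fun_mxP mu /measurable_fun_mxP mv.
apply/measurable_fun_mxP => i j; under eq_fun do rewrite mxE.
exact: measurable_funD.
Qed.

Lemma measurable_mxB m n (u v : T -> 'M[R]_(m, n)) :
  measurable_fun [set: T] u -> measurable_fun [set: T] v ->
  measurable_fun [set: T] (fun t => u t - v t).
Proof.
move=> /measurable_fun_mxP mu /measurable_fun_mxP mv.
apply/measurable_fun_mxP => i j; under eq_fun do rewrite !mxE.
exact: measurable_funB.
Qed.

Lemma measurable_bform m n (M : 'M[R]_(m, n)) (u : T -> 'cV[R]_m)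
    (v : T -> 'cV[R]_n) :
  measurable_fun [set: T] u -> measurable_fun [set: T] v ->
  measurable_fun [set: T] (fun t => bform M (u t) (v t)).
Proof.
move=> /measurable_fun_mxP mu /measurable_fun_mxP mv.
under eq_fun do rewrite bform_sumE.
apply: measurable_sum => i; apply: measurable_sum => j.
by apply: measurable_funM => //; apply: measurable_funM.
Qed.

End measurable_vectors.

Section lebesgue_translation.
Context {R : realType}.
Local Open Scope ereal_scope.
Local Notation leb := (@lebesgue_measure R).

Let measurable_shift (a : R) : measurable_fun [set: measurableTypeR R]
  (fun x : measurableTypeR R => (x + a)%R : measurableTypeR R).
Proof. exact: measurable_funD. Qed.

Let leb_shift (a : R) : {measure set (measurableTypeR R) -> \bar R} :=
  measure_function_pushforward__canonical__measure_function_Measure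
    leb (measurable_shift a).

Lemma lebesgue_measure_shift (a : R) (A : set R) : measurable A ->
  leb_shift a A = leb A.
Proof.
move=> mA; apply/esym.
apply: (@lebesgue_measure_unique R (leb_shift a)) => // _ [[x y] _ <-].
rewrite /leb_shift/= /pushforward (_ : _ @^-1` _ = `](x - a)%R, (y - a)%R]%classic).
  rewrite !lebesgue_measure_itv/= !lte_fin ltrD2r; case: ifPn => // _.
  by rewrite -!EFinB opprB addrA subrK.
by apply/seteqP; split=> z /=; rewrite !in_itv/= ltrBlDr lerBrDr.
Qed.

Lemma integral_shift_R (a : R) (f : R -> \bar R) :
  measurable_fun [set: R] f -> (forall x, 0 <= f x) ->
  \int[leb]_x f (x + a)%R = \int[leb]_x f x.
Proof.
move=> mf f0; have ms := measurable_shift a.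
rewrite -[LHS](@ge0_integral_pushforward _ _ _ _ _ _ ms leb setT f)//.
have leb_shiftE (A : set (measurableTypeR R)) :
  measurable A -> A `<=` setT -> leb_shift a A = leb A.
  by move=> mA _; exact: lebesgue_measure_shift.
exact: (@eq_measure_integral _ _ _ setT leb (leb_shift a) f leb_shiftE).
Qed.

End lebesgue_translation.

Section integral_lebesgue_cV.
Context {R : realType}.
Local Open Scope ereal_scope.
Local Notation mu n := (@lebesgue_cV R n).
Local Notation leb := (@lebesgue_measure R).

Lemma integral_cV0 (f : 'cV[R]_0 -> \bar R) : measurable_fun setT f ->
  \int[mu 0]_v f v = f 0%R.
Proof. by move=> mf; rewrite integral_dirac// diracT mul1e. Qed.

Lemma integral_cV_cons n (f : 'cV[R]_n.+1 -> \bar R) :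
  measurable_fun setT f -> (forall v, 0 <= f v) ->
  \int[mu n.+1]_v f v =
  \int[@lebesgue_measure R]_x \int[mu n]_v f (cV_cons (x, v)).
Proof.
move=> mf f0.
have mc : measurable_fun [set: measurableTypeR R * 'cV[R]_n] (@cV_cons R n).
  exact: measurable_cV_cons.
pose m : {measure set (measurableTypeR R * 'cV[R]_n) -> \bar R} := @lebesgue_measure R \x mu n.
rewrite [LHS](@ge0_integral_pushforward _ _ _ _ _ _ mc m setT f)//.
rewrite preimage_setT [LHS](@fubini_tonelli1 _ _ (measurableTypeR R) 'cV[R]_n R
  leb (mu n) (f \o @cV_cons R n))//.
by apply: (measurableT_comp mf mc).
by move=> z; exact: f0.
Qed.

Lemma cV_consD n (x y : R) (v w : 'cV[R]_n) :
  (cV_cons (x, v) + cV_cons (y, w))%R = cV_cons ((x + y)%R, (v + w)%R).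
Proof.
by apply/matrixP => i j; rewrite !mxE; case: unliftP => [k|] _; rewrite ?mxE ?ord1.
Qed.

Lemma cV_unconsK n : cancel (@cV_uncons R n) (@cV_cons R n).
Proof.
move=> v; apply/matrixP => i j; rewrite mxE ord1.
by case: unliftP => [k|] -> /=; rewrite ?mxE.
Qed.

Lemma measurable_shift_cV n (a : 'cV[R]_n) :
  measurable_fun [set: 'cV[R]_n] (fun v : 'cV[R]_n => (v + a)%R).
Proof. exact: measurable_mxD. Qed.

(** Induction along the construction of [lebesgue_cV]: the tail is translated by the induction
    hypothesis, the first coordinate by the one-dimensional case. *)
Lemma integral_shift_cV n (a : 'cV[R]_n) (f : 'cV[R]_n -> \bar R) :
  measurable_fun setT f -> (forall v, 0 <= f v) ->
  \int[mu n]_v f (v + a)%R = \int[mu n]_v f v.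
Proof.
elim: n a f => [|n IHn] a f mf f0.
  by apply: eq_integral => v _; congr f; rewrite [LHS]flatmx0 [RHS]flatmx0.
have mfa : measurable_fun setT (fun v : 'cV[R]_n.+1 => f (v + a)%R).
  by apply: measurableT_comp => //; exact: measurable_shift_cV.
have mfc : measurable_fun setT (f \o @cV_cons R n).
  by apply: measurableT_comp => //; exact: measurable_cV_cons.
rewrite (integral_cV_cons mfa (fun v => f0 _)) (integral_cV_cons mf f0).
rewrite -[a]cV_unconsK; move: (cV_uncons a) => [b c].
under eq_integral => x _.
  under eq_integral do rewrite cV_consD.
  rewrite (IHn c (fun v => f (cV_cons ((x + b)%R, v))))//; last first.
    exact: (measurableT_comp mfc (pair1_measurable _)).
  over.
rewrite /= (@integral_shift_R R b (fun x : R => \int[mu n]_v f (cV_cons (x, v))))//.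
- exact: (measurable_fun_fubini_tonelli_F (f \o @cV_cons R n) mfc (fun z => f0 _)).
- by move=> x; apply: integral_ge0 => v _; exact: f0.
Qed.

End integral_lebesgue_cV.

(** * Gaussian integrals *)

Section gaussian_integrals.
Context {R : realType}.
Local Notation mu n := (@lebesgue_cV R n).

Lemma measurable_bform_cV n (M : 'M[R]_n) :
  measurable_fun [set: 'cV[R]_n] (fun v => bform M v v).
Proof. by apply: measurable_bform; exact: measurable_id. Qed.

Lemma measurable_expR_bform n (M : 'M[R]_n) :
  measurable_fun [set: 'cV[R]_n] (fun v => expR (- bform M v v / 2)).
Proof.
apply: measurableT_comp => //; apply: measurable_funM => //.
apply: measurable_funN; exact: measurable_bform_cV.
Qed.

(** The integrand is a multiple of the density of N(-c, 1/p). *)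
Lemma integral_gauss_R (p c : R) : 0 < p ->
  (\int[@lebesgue_measure R]_x (expR (- (p * (x + c) ^+ 2) / 2))%:E =
   (Num.sqrt (2 * pi / p))%:E)%E.
Proof.
move=> p0; set s := Num.sqrt p^-1.
have s2 : s ^+ 2 = p^-1 by rewrite sqr_sqrtr// invr_ge0 ltW.
have s0 : s != 0 by rewrite gt_eqF// sqrtr_gt0 invr_gt0.
have E x : expR (- (p * (x + c) ^+ 2) / 2) =
    Num.sqrt (2 * pi / p) * normal_pdf (- c) s x.
  rewrite normal_pdfE// /normal_peak /normal_fun s2 opprK [RHS]mulrA.
  rewrite (_ : p^-1 * pi *+ 2 = 2 * pi / p); last by rewrite -mulr_natl; ring.
    rewrite divff ?mul1r; last first.
    by rewrite gt_eqF// sqrtr_gt0 divr_gt0// mulr_gt0// pi_gt0.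
  by congr expR; rewrite -mulr_natr; field; rewrite gt_eqF.
under eq_integral do rewrite E EFinM.
rewrite ge0_integralZl_EFin//=.
- by rewrite integral_normal_pdf mule1.
- by move=> x _; rewrite lee_fin normal_pdf_ge0.
- apply/measurable_EFinP; exact: measurable_normal_pdf.
Qed.

Lemma cV_cons_col_mx n (x : R) (v : 'cV[R]_n) :
  cV_cons (x, v) = col_mx (const_mx x : 'cV_1) v.
Proof.
apply/matrixP => i j; rewrite ord1 mxE; case: unliftP => [k|] -> /=.
  transitivity (col_mx (const_mx x : 'cV_1) v (rshift 1 k) 0).
    by rewrite col_mxEd.
  by congr (col_mx _ _ _ _); apply/val_inj.
transitivity (col_mx (const_mx x : 'cV_1) v (lshift n 0) 0).
  by rewrite col_mxEu mxE.
by congr (col_mx _ _ _ _); apply/val_inj.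
Qed.

(** Tonelli lets the first coordinate be integrated first. By [bform_schur] this is a shifted
    one-dimensional Gaussian whose integral does not depend on the other coordinates; the induction
    hypothesis handles the Schur complement, and det P = p det S joins the constants. *)
Lemma integral_expR_bform n (P : 'M[R]_n) : sym_posdef P ->
  (\int[mu n]_v (expR (- bform P v v / 2))%:E =
   (Num.sqrt ((2 * pi) ^+ n / \det P))%:E)%E.
Proof.
elim: n P => [|n IHn] P sP.
  rewrite integral_cV0; last by apply/measurable_EFinP; exact: measurable_expR_bform.
  by rewrite bform0r oppr0 mul0r expR0 det_mx00 divr1 sqrtr1.
rewrite integral_cV_cons; last 2 first.
- by apply/measurable_EFinP; exact: measurable_expR_bform.
- by move=> v; rewrite lee_fin expR_ge0.
set S := schur_compl (P : 'M[R]_(1 + n)).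
pose p : R := P 0 0.
pose b : 'rV[R]_n := ursubmx (P : 'M[R]_(1 + n)).
have E x v : expR (- bform P (cV_cons (x, v)) (cV_cons (x, v)) / 2) =
    expR (- bform S v v / 2) * expR (- (p * (x + p^-1 * (b *m v) 0 0) ^+ 2) / 2).
  rewrite cV_cons_col_mx (@bform_schur R n P)// -expRD [const_mx x 0 0]mxE; congr expR.
  rewrite -/S -/b -/p; ring.
have mf : measurable_fun setT (fun z : R * 'cV[R]_n =>
    (expR (- bform P (cV_cons z) (cV_cons z) / 2))%:E).
  apply/measurable_EFinP; apply: (measurableT_comp (measurable_expR_bform P)).
  exact: measurable_cV_cons.
rewrite [LHS](@fubini_tonelli _ _ (measurableTypeR R) 'cV[R]_n R
    (@lebesgue_measure R) (mu n) _ mf); last first.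
  by move=> z; rewrite lee_fin expR_ge0.
have p0 : 0 < p by exact: (@schur_pivot_gt0 R n P).
transitivity (\int[mu n]_v ((expR (- bform S v v / 2))%:E *
    (Num.sqrt (2 * pi / p))%:E))%E.
  apply: eq_integral => v _ /=.
  rewrite -(integral_gauss_R (p^-1 * (b *m v) 0 0) p0).
  rewrite -ge0_integralZl_EFin ?expR_ge0//.
  - by apply: eq_integral => x _; rewrite E EFinM.
  - apply/measurable_EFinP; apply: measurableT_comp => //.
    apply: measurable_funM => //; apply: measurable_funN.
    by apply: measurable_funM => //; apply: measurable_funX; exact: measurable_funD.
rewrite ge0_integralZr//=.
- rewrite IHn; last exact: spd_schur.
  rewrite -EFinM -sqrtrM; last first.
    by rewrite divr_ge0 ?exprn_ge0 ?mulr_ge0 ?pi_ge0// ltW// spd_det_gt0//; exact: spd_schur.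
  congr (Num.sqrt _)%:E; rewrite (@det_schur R n P)// -/p -/S exprS invfM.
  by ring.
- by apply/measurable_EFinP; exact: measurable_expR_bform.
Qed.

End gaussian_integrals.

(** * Mean of the quadratic form under a centred Gaussian *)

Section gaussian_second_moment.
Context {R : realType}.
Local Notation mu n := (@lebesgue_cV R n).

Lemma spd_scale n (P : 'M[R]_n) a : 0 < a -> sym_posdef P -> sym_posdef (a *: P).
Proof.
move=> a0 sP; split; first by rewrite linearZ /= (spd_tr sP).
move=> v v0; rewrite -scalemxAr -scalemxAl mxE mulr_gt0//.
exact: (spd_gt0 sP).
Qed.

Lemma bform_scalemx m n (M : 'M[R]_(m, n)) a u v :
  bform (a *: M) u v = a * bform M u v.
Proof. by rewrite /bform -scalemxAr -scalemxAl mxE. Qed.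

Lemma integral_expR_bform_scale n (P : 'M[R]_n) u : sym_posdef P -> 0 < u ->
  (\int[mu n]_v (expR (- (u ^+ 2 * bform P v v) / 2))%:E =
   ((u ^+ n)^-1 * Num.sqrt ((2 * pi) ^+ n / \det P))%:E)%E.
Proof.
move=> sP u0; have u20 : 0 < u ^+ 2 by rewrite exprn_gt0.
under eq_integral do rewrite -bform_scalemx.
rewrite integral_expR_bform; last exact: spd_scale.
congr (_%:E); rewrite detZ -exprM mulnC exprM invfM mulrCA sqrtrM; last first.
  by rewrite invr_ge0 sqr_ge0.
by rewrite -exprVn sqrtr_sqr ger0_norm// invr_ge0 exprn_ge0// ltW.
Qed.

(** Stands in for a derivative: inequalities valid on each side of a, once divided by u - a,
    determine the value at a by one-sided limits. *)
Lemma sign_change_root (p : {poly R}) (a : R) :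
  (forall u, a - 1 < u < a -> p.[u] <= 0) -> (forall u, a < u -> 0 <= p.[u]) -> p.[a] = 0.
Proof.
move=> pl pr; apply/eqP; rewrite eq_le; apply/andP; split.
  have : p.[x] @[x --> a^'-] --> p.[a].
    by apply: cvg_at_left_filter; exact: continuous_horner.
  move/cvgr_to_le; apply; near=> x; apply: pl; apply/andP; split.
    by near: x; apply: nbhs_left_gt; rewrite ltrBlDr ltrDl.
  by near: x; exact: nbhs_left_lt.
have : p.[x] @[x --> a^'+] --> p.[a].
  by apply: cvg_at_right_filter; exact: continuous_horner.
move/cvgr_to_ge; apply; near=> x; apply: pr.
by near: x; exact: nbhs_right_gt.
Unshelve. all: by end_near. Qed.

(* Differentiating u |-> int exp(-u^2 Q/2) = u^-n Z at u = 1: convexity of exp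
   bounds the increments on both sides of 1 by multiples of the moment. *)
Lemma integral_bform_expR n (P : 'M[R]_n) : sym_posdef P ->
  (\int[mu n]_v (bform P v v * expR (- bform P v v / 2))%:E =
   (n%:R * Num.sqrt ((2 * pi) ^+ n / \det P))%:E)%E.
Proof.
move=> sP; set Z := Num.sqrt _.
pose e u v := expR (- (u ^+ 2 * bform P v v) / 2).
have me u : measurable_fun setT (EFin \o e u).
  apply/measurable_EFinP; apply: measurableT_comp => //; apply: measurable_funM => //.
  by apply: measurable_funN; apply: measurable_funM => //; exact: measurable_bform_cV.
have e1E v : expR (- bform P v v / 2) = e 1 v by rewrite /e expr1n mul1r.
under eq_integral do rewrite e1E.
have intE u : 0 < u -> (\int[mu n]_v (e u v)%:E = ((u ^+ n)^-1 * Z)%:E)%E.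
  exact: integral_expR_bform_scale.
have mh : measurable_fun setT (fun v : 'cV[R]_n => (bform P v v * e 1 v)%:E).
  apply/measurable_EFinP; apply: measurable_funM; first exact: measurable_bform_cV.
  exact/measurable_EFinP.
have h0 v : 0 <= bform P v v * e 1 v by rewrite mulr_ge0 ?spd_ge0 ?expR_ge0.
have e0 u v : 0 <= e u v by exact: expR_ge0.
(* exp(t) >= 1 + t at t = (1 - u^2) Q / 2, where Q is the quadratic form. *)
have convex u v : e 1 v + (1 - u ^+ 2) / 2 * (bform P v v * e 1 v) <= e u v.
  have -> : e u v = e 1 v * expR ((1 - u ^+ 2) / 2 * bform P v v).
    by rewrite -expRD; congr expR; field.
  rewrite (_ : _ + _ = e 1 v * (1 + (1 - u ^+ 2) / 2 * bform P v v)); last by ring.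
  by rewrite ler_wpM2l// expR_ge1Dx.
have e0E u v : ([set: 'cV[R]_n] v -> 0 <= (e u v)%:E)%E by rewrite lee_fin.
have ch0E c v : 0 <= c -> (0 <= c%:E * (bform P v v * e 1 v)%:E)%E.
  by move=> c0; rewrite mule_ge0 ?lee_fin.
have mch c : measurable_fun setT (fun v : 'cV[R]_n => (c%:E * (bform P v v * e 1 v)%:E)%E).
  exact: emeasurable_funM.
set J := (\int[mu n]_v (bform P v v * e 1 v)%:E)%E.
have J0 : (0 <= J)%E by apply: integral_ge0 => v _; rewrite lee_fin.
have intD u c : 0 < u -> 0 <= c ->
    (\int[mu n]_v ((e u v)%:E + c%:E * (bform P v v * e 1 v)%:E) =
     ((u ^+ n)^-1 * Z)%:E + c%:E * J)%E.
  move=> u0 c0; rewrite (@ge0_integralD _ _ _ (mu n) setT measurableT _ _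
    (@e0E u) (me u) (fun v _ => ch0E c v c0) (mch c)) intE//.
  rewrite ge0_integralZl_EFin// => v _; exact: h0.
have Z1 : Z = (1 ^+ n)^-1 * Z by rewrite expr1n invr1 mul1r.
(* The cases u < 1 and u > 1 put the moment on opposite sides, so that every coefficient is
   nonnegative and the integrals add up before [J] is known to be finite. *)
have boundl u : 0 < u < 1 -> (Z%:E + ((1 - u ^+ 2) / 2)%:E * J <= ((u ^+ n)^-1 * Z)%:E)%E.
  move=> /andP[u0 u1]; have c0 : 0 <= (1 - u ^+ 2) / 2.
    by rewrite divr_ge0// subr_ge0 expr_le1// ltW.
  rewrite {1}Z1 -intD// -intE//; apply: ge0_le_integral => //.
  - by move=> v _; apply: adde_ge0; [rewrite lee_fin|exact: ch0E].
  - exact: (emeasurable_funD (me 1) (mch _)).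
  - exact: me.
  - by move=> v _; rewrite -EFinM -EFinD lee_fin.
have boundr u : 1 < u -> (Z%:E <= ((u ^+ n)^-1 * Z)%:E + ((u ^+ 2 - 1) / 2)%:E * J)%E.
  move=> u1; have u0 : 0 < u by rewrite (lt_trans _ u1).
  have c0 : 0 <= (u ^+ 2 - 1) / 2.
    by rewrite divr_ge0// subr_ge0 expr_ge1// ltW.
  rewrite {1}Z1 -intD// -intE//; apply: ge0_le_integral => //.
  - by move=> v _; rewrite lee_fin.
  - exact: me.
  - exact: (emeasurable_funD (me u) (mch _)).
  - move=> v _; rewrite -EFinM -EFinD lee_fin.
    have := convex u v; rewrite -lerBrDr => /le_trans; apply.
    by rewrite lerD2l -opprB mulNr mulNr opprK.
(* The bound at u = 1/2 has a positive coefficient on [J] and a finite right-hand side. *)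
have : J \is a fin_num.
  have h1 : (2^-1 : R) < 1 by rewrite invf_lt1 ?ltr1n.
  have := boundl 2^-1; rewrite h1 andbT invr_gt0 ltr0n => /(_ isT).
  case: (J) J0 => [j| |]//= _; rewrite gt0_muley ?addey// lte_fin.
  by rewrite divr_gt0// subr_gt0 exprn_ilt1// invr_ge0.
move: boundl boundr J0; clear intD; case: J => [j| |]//= boundl boundr j0 _; congr (_%:E).
(* Both bounds concern the sign of u^-n Z + (u^2 - 1)/2 j - Z. Multiplied by u^n and divided by u -
   1 this is p(u), and p(1) = j - n Z. *)
pose p : {poly R} := (j / 2) *: ((1 + 'X) * 'X^n) - Z *: \sum_(i < n) 'X^i.
have pE u : p.[u] = j / 2 * ((1 + u) * u ^+ n) - Z * \sum_(i < n) u ^+ i.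
  rewrite !hornerE horner_sum; congr (_ - _ * _).
  by apply: eq_bigr => i _; rewrite !hornerE.
have pZ u : u != 0 -> (u - 1) * p.[u] = u ^+ n * ((u ^+ n)^-1 * Z + (u ^+ 2 - 1) / 2 * j - Z).
  move=> u0; rewrite pE mulrBr (mulrCA _ Z) -subrX1.
  by field; rewrite expf_neq0.
suff : p.[1] = 0.
  rewrite pE (eq_bigr (fun=> 1)) => [|i _]; last by rewrite expr1n.
  rewrite sumr_const card_ord expr1n => /eqP; rewrite subr_eq0 => /eqP.
  by rewrite (mulrC Z) => <-; field.
apply: sign_change_root => u.
- rewrite subrr => /andP[u0 u1]; have := boundl u; rewrite u0 u1 => /(_ isT).
  rewrite -EFinM -EFinD lee_fin => H.
  have : 0 <= (u - 1) * p.[u].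
    rewrite pZ ?gt_eqF// mulr_ge0 ?exprn_ge0 ?(ltW u0)//.
    by move: (_ * Z) H => w H; lra.
  by rewrite nmulr_rge0// subr_lt0.
- move=> u1; have u0 : 0 < u by rewrite (lt_trans _ u1).
  have := boundr u u1; rewrite -EFinM -EFinD lee_fin => H.
  have : 0 <= (u - 1) * p.[u].
    by rewrite pZ ?gt_eqF// mulr_ge0 ?exprn_ge0 ?(ltW u0)// subr_ge0.
  by rewrite pmulr_rge0// subr_gt0.
Qed.

End gaussian_second_moment.

(** * Densities and entropy *)

Section densities.
Context d (T : measurableType d) (R : realType).
Local Open Scope ereal_scope.
Variables mu nu : {measure set T -> \bar R}.
Import HBNNSimple.

(** For indicators this is the definition of a density; simple functions follow by linearity and g
    by monotone convergence. *)
Lemma integral_is_density (f : T -> R) (g : T -> \bar R) : is_density mu nu f ->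
  measurable_fun setT g -> (forall x, 0 <= g x) ->
  \int[nu]_x g x = \int[mu]_x (g x * (f x)%:E).
Proof.
move=> [mf f0 nuE] mg g0; pose h := nnsfun_approx measurableT mg.
have mfE : measurable_fun setT (EFin \o f) by apply/measurable_EFinP.
have hg x : EFin \o h ^~ x @ \oo --> g x by exact: cvg_nnsfun_approx.
have -> : \int[nu]_x g x = limn (fun n => \int[nu]_x (h n x)%:E).
  rewrite -monotone_convergence//.
  - by apply: eq_integral => x _; apply/esym/cvg_lim => //; exact: hg.
  - by move=> n; apply/measurable_EFinP.
  - by move=> n x _; rewrite lee_fin.
  - by move=> x _ a b ab; rewrite lee_fin; exact/lefP/nd_nnsfun_approx.
have -> : \int[mu]_x (g x * (f x)%:E) = limn (fun n => \int[mu]_x ((h n x)%:E * (f x)%:E)).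
  rewrite -monotone_convergence//.
  - apply: eq_integral => x _; apply/esym/cvg_lim => //; apply: cvgeZr => //; exact: hg.
  - by move=> n; apply: emeasurable_funM => //; apply/measurable_EFinP.
  - by move=> n x _; rewrite mule_ge0 ?lee_fin.
  - by move=> x _ a b ab; rewrite lee_wpmul2r ?lee_fin//; exact/lefP/nd_nnsfun_approx.
suff E n : \int[nu]_x (h n x)%:E = \int[mu]_x ((h n x)%:E * (f x)%:E).
  by under eq_fun do rewrite E.
transitivity (\sum_(y \in range (h n)) \int[nu]_x (y * \1_(h n @^-1` [set y]) x)%:E).
  rewrite -ge0_integral_fsum//.
  - by apply: eq_integral => x _; rewrite fimfunE -fsumEFin.
  - by move=> y; apply/measurable_EFinP; exact: measurable_funM.
  - by move=> y x _; exact: nnfun_muleindic_ge0.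
transitivity (\sum_(y \in range (h n)) \int[mu]_x ((y * \1_(h n @^-1` [set y]) x)%:E * (f x)%:E)).
  apply: eq_fsbigr => y /set_mem[t _ yt].
  have y0 : (0 <= y)%R by rewrite -yt.
  have mA : measurable (h n @^-1` [set y]) by [].
  under eq_integral do rewrite EFinM.
  under [RHS]eq_integral do rewrite EFinM -muleA.
  rewrite ge0_integralZl_EFin//; last by apply/measurable_EFinP.
  rewrite ge0_integralZl_EFin//; last 2 first.
  - by move=> x _; rewrite mule_ge0 ?lee_fin.
  - by apply: emeasurable_funM => //; apply/measurable_EFinP.
  rewrite integral_indic// setIT nuE// integral_mkcond epatch_indic.
  by congr (_ * _); apply: eq_integral => x _ /=; rewrite muleC.
rewrite -ge0_integral_fsum//.
- apply: eq_integral => x _; rewrite -ge0_mule_fsuml => [|y]; last exact: nnfun_muleindic_ge0.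
  by rewrite fsumEFin// -fimfunE.
- by move=> y; apply: emeasurable_funM => //; apply/measurable_EFinP; exact: measurable_funM.
- by move=> y x _; rewrite mule_ge0 ?lee_fin// -lee_fin nnfun_muleindic_ge0.
Qed.

Lemma is_density_integrable (f : T -> R) : is_density mu nu f ->
  nu setT < +oo -> mu.-integrable setT (EFin \o f).
Proof.
move=> [mf f0 nuE] nuoo; apply/integrableP; split; first exact/measurable_EFinP.
under eq_integral do rewrite /= ger0_norm//.
by rewrite -nuE.
Qed.

Lemma is_density_ae_eq (f g : T -> R) : is_density mu nu f -> is_density mu nu g ->
  nu setT < +oo -> ae_eq mu setT (EFin \o f) (EFin \o g).
Proof.
move=> df dg nuoo; apply: integral_ae_eq => //.
- exact: is_density_integrable.
- by case: dg => mg _ _; apply/measurable_EFinP.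
- move=> A _ mA; case: df dg => _ _ fE [_ _ gE].
  by rewrite -fE// -gE.
Qed.

Lemma is_density_abs_cont (f : T -> R) (A : set T) : is_density mu nu f ->
  measurable A -> mu A = 0 -> nu A = 0.
Proof.
move=> [mf f0 nuE] mA A0; rewrite nuE// null_set_integral//.
exact/measurable_funTS/measurable_EFinP.
Qed.

Lemma is_density_ae (f : T -> R) (Q : T -> Prop) : is_density mu nu f ->
  {ae mu, forall x, Q x} -> {ae nu, forall x, Q x}.
Proof.
move=> df [N [mN N0 QN]]; exists N; split => //.
exact: is_density_abs_cont df mN N0.
Qed.

(** If -ln f = c + Q/2 and Q has mean k, the entropy is c + k/2. The base space is abstract so that
    both R^n and the product space of the joint law are covered. *)
Lemma entropy_exp_density (f Q : T -> R) (c k : R) : is_density mu nu f ->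
  nu setT = 1 -> measurable_fun setT Q -> (forall x, 0 <= Q x)%R ->
  (forall x, - ln (f x) = c + Q x / 2)%R ->
  \int[mu]_x (Q x * f x)%:E = k%:E ->
  entropy mu nu = (c + k / 2)%:E.
Proof.
move=> df nu1 mQ Q0 lnf Qk; have [mf f0 nuE] := df.
rewrite /entropy; set g := density_in _ _ _.
have dg : is_density mu nu g.
  rewrite /g /density_in; case: xgetP => [g' _ []//|/(_ f)]; by case.
have mg := density_in_measurable setT mu nu.
rewrite (ae_eq_integral (fun x => (c + Q x / 2)%:E))//=.
- have IQ : \int[nu]_x (Q x)%:E = k%:E.
    rewrite -Qk; under [RHS]eq_integral do rewrite EFinM.
    by apply: (integral_is_density df) => //; apply/measurable_EFinP.
  have iQ : nu.-integrable setT (EFin \o Q).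
    apply/integrableP; split; first exact/measurable_EFinP.
    under eq_integral do rewrite /= ger0_norm//.
    by rewrite IQ ltry.
  under eq_integral do rewrite EFinD EFinM muleC.
  rewrite integralD//=; last 2 first.
  - apply/integrableP; split; first exact: measurable_cst.
    by rewrite integral_cst//= nu1 mule1 ltry.
  - exact: integrableZl.
  rewrite integral_cst// nu1 mule1 integralZl//= IQ EFinD mulrC EFinM.
  by [].
- by apply/measurable_EFinP; apply: measurable_funN; exact: measurableT_comp mg.
- apply/measurable_EFinP; apply: measurable_funD => //; exact: measurable_funM.
(* The density chosen by [entropy] agrees with f only mu-almost everywhere; this suffices because
   mu-null sets are nu-null. *)
- apply: (is_density_ae df).
  apply: filterS (is_density_ae_eq dg df _); last by rewrite nu1 ltry.
  by move=> x /= /(_ I) [->] _; rewrite lnf.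
Qed.

End densities.

(** * Gaussian laws *)

Lemma ge0_integralZlR d (T : measurableType d) (R : realType)
    (mu : {measure set T -> \bar R}) (f : T -> R) (k : R) :
  measurable_fun setT f -> (forall x, 0 <= f x) -> 0 <= k ->
  (\int[mu]_x (k * f x)%:E = k%:E * \int[mu]_x (f x)%:E)%E.
Proof.
move=> mf f0 k0; under eq_integral do rewrite EFinM.
rewrite ge0_integralZl_EFin//; first by move=> x _; rewrite lee_fin.
exact/measurable_EFinP.
Qed.

Lemma ge0_integralZlT d (T : measurableType d) (R : realType)
    (mu : {measure set T -> \bar R}) (f : T -> \bar R) (k : \bar R) :
  (measurable_fun setT f -> (forall x, 0 <= f x) -> 0 <= k ->
  \int[mu]_x (k * f x) = k * \int[mu]_x f x)%E.
Proof. by move=> mf f0 k0; exact: ge0_integralZl. Qed.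

Section gaussian_density.
Context {R : realType}.
Local Notation mu n := (@lebesgue_cV R n).

Definition gaussian_norm n (C : 'M[R]_n) : R := Num.sqrt ((2 * pi) ^+ n * \det C).

Lemma gaussian_pdfE n (m : 'cV[R]_n) C x : gaussian_pdf m C x =
  (gaussian_norm C)^-1 * expR (- bform (invmx C) (x - m) (x - m) / 2).
Proof. by []. Qed.

Lemma gaussian_pdf_center n (m : 'cV[R]_n) C x :
  gaussian_pdf m C x = gaussian_pdf 0 C (x - m).
Proof. by rewrite !gaussian_pdfE subr0. Qed.

Lemma gaussian_norm_gt0 n (C : 'M[R]_n) : sym_posdef C -> 0 < gaussian_norm C.
Proof.
move=> sC; rewrite sqrtr_gt0 mulr_gt0 ?spd_det_gt0// exprn_gt0// mulr_gt0//.
exact: pi_gt0.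
Qed.

Lemma gaussian_pdf_ge0 n (m : 'cV[R]_n) C x : 0 <= gaussian_pdf m C x.
Proof. by rewrite mulr_ge0 ?expR_ge0// invr_ge0 sqrtr_ge0. Qed.

Lemma gaussian_pdf_gt0 n (m : 'cV[R]_n) C x : sym_posdef C -> 0 < gaussian_pdf m C x.
Proof. by move=> sC; rewrite mulr_gt0 ?expR_gt0// invr_gt0 gaussian_norm_gt0. Qed.

Lemma ln_gaussian_pdf n (m : 'cV[R]_n) C x : sym_posdef C ->
  - ln (gaussian_pdf m C x) =
  ln (gaussian_norm C) + bform (invmx C) (x - m) (x - m) / 2.
Proof.
move=> sC; have N0 := gaussian_norm_gt0 sC.
rewrite gaussian_pdfE lnM ?posrE ?invr_gt0 ?expR_gt0// lnV ?posrE// expRK.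
by rewrite opprD opprK mulNr opprK.
Qed.

Lemma measurable_gaussian_pdf d (T : measurableType d) n (m : 'cV[R]_n) C
    (u : T -> 'cV[R]_n) : measurable_fun setT u ->
  measurable_fun setT (fun t => gaussian_pdf m C (u t)).
Proof.
move=> mu; apply: measurable_funM => //; apply: measurableT_comp => //.
apply: measurable_funM => //; apply: measurable_funN.
by apply: measurable_bform; apply: measurable_mxB.
Qed.

Lemma integral_gaussian_pdf n (m : 'cV[R]_n) C : sym_posdef C ->
  (\int[mu n]_x (gaussian_pdf m C x)%:E = 1)%E.
Proof.
move=> sC; under eq_integral do rewrite gaussian_pdf_center.
rewrite (integral_shift_cV (- m) (f := fun x => (gaussian_pdf 0 C x)%:E)); last 2 first.
- by apply/measurable_EFinP; exact: measurable_gaussian_pdf.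
- by move=> x; rewrite lee_fin gaussian_pdf_ge0.
have N0 : 0 <= (gaussian_norm C)^-1 by rewrite invr_ge0 ltW// gaussian_norm_gt0.
under eq_integral do rewrite gaussian_pdfE subr0.
rewrite (ge0_integralZlR _ (measurable_expR_bform _) (fun=> expR_ge0 _) N0).
rewrite integral_expR_bform; last exact: spd_inv.
by rewrite det_inv invrK -EFinM mulVf// gt_eqF// gaussian_norm_gt0.
Qed.

Lemma integral_bform_gaussian n (m : 'cV[R]_n) C : sym_posdef C ->
  (\int[mu n]_x (bform (invmx C) (x - m) (x - m) * gaussian_pdf m C x)%:E = n%:R%:E)%E.
Proof.
move=> sC; under eq_integral do rewrite gaussian_pdf_center.
have mQ : measurable_fun setT (fun x : 'cV[R]_n => bform (invmx C) x x * gaussian_pdf 0 C x).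
  by apply: measurable_funM; [exact: measurable_bform_cV|exact: measurable_gaussian_pdf].
rewrite (integral_shift_cV (- m)
    (f := fun x => (bform (invmx C) x x * gaussian_pdf 0 C x)%:E)); last 2 first.
- exact/measurable_EFinP.
- by move=> x; rewrite lee_fin mulr_ge0 ?gaussian_pdf_ge0// spd_ge0//; exact: spd_inv.
have N0 : 0 <= (gaussian_norm C)^-1 by rewrite invr_ge0 ltW// gaussian_norm_gt0.
under eq_integral do rewrite gaussian_pdfE subr0 mulrCA.
rewrite ge0_integralZlR//; last first.
- by move=> x; rewrite mulr_ge0 ?expR_ge0// spd_ge0//; exact: spd_inv.
- apply: measurable_funM; first exact: measurable_bform_cV.
  exact: measurable_expR_bform.
rewrite integral_bform_expR; last exact: spd_inv.
by rewrite det_inv invrK -EFinM mulrCA mulVf ?mulr1// gt_eqF// gaussian_norm_gt0.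
Qed.

End gaussian_density.

(** * Linear images of Gaussian laws *)

Section gaussian_image.
Context {R : realType} n r (C : 'M[R]_n) (A : 'M[R]_(r, n)).
Local Notation mu n := (@lebesgue_cV R n).
Local Notation S := (A *m C *m A^T).
Hypotheses (sC : sym_posdef C) (sS : sym_posdef S).
Let K := C *m A^T *m invmx S.

Let AK : A *m K = 1%:M.
Proof. by rewrite /K !mulmxA mulmxV// spd_unit. Qed.

Let pdfM x w : gaussian_pdf 0 C (x + K *m (w - A *m x)) * gaussian_pdf 0 S (w - A *m x) =
  gaussian_pdf 0 C (x - K *m w) * gaussian_pdf 0 S w.
Proof.
rewrite !gaussian_pdfE !subr0 mulrACA [RHS]mulrACA -!expRD; congr (_ * expR _).
by rewrite -!mulrDl -!opprD (complete_square_image sC sS).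
Qed.

(* Insert 1 = int psi for psi the density of N(0, A C A^T), translate x by K w
   with A K = 1, then w by - A x; the integrand becomes
   f(w) phi(x - K w) psi(w), and x integrates out. *)
Lemma integral_gaussian_image0 (f : 'cV[R]_r -> \bar R) :
  measurable_fun setT f -> (forall w, 0 <= f w)%E ->
  (\int[mu n]_x (f (A *m x) * (gaussian_pdf 0 C x)%:E) =
   \int[mu r]_w (f w * (gaussian_pdf 0 S w)%:E))%E.
Proof.
move=> mf f0.
pose phi := gaussian_pdf (0 : 'cV[R]_n) C; pose psi := gaussian_pdf (0 : 'cV[R]_r) S.
pose T : measurableType _ := ('cV[R]_n * 'cV[R]_r)%type.
have m1 : measurable_fun [set: T] fst by exact: measurable_fst.
have m2 : measurable_fun [set: T] snd by exact: measurable_snd.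
have mphi (u : T -> 'cV[R]_n) : measurable_fun setT u -> measurable_fun setT (EFin \o (phi \o u)).
  by move=> mu; apply/measurable_EFinP; exact: measurable_gaussian_pdf.
have mpsi (u : T -> 'cV[R]_r) : measurable_fun setT u -> measurable_fun setT (EFin \o (psi \o u)).
  by move=> mu; apply/measurable_EFinP; exact: measurable_gaussian_pdf.
pose F (z : T) := (f (A *m z.1) * ((phi z.1)%:E * (psi z.2)%:E))%E.
pose G (z : T) := (f (A *m z.1 + z.2)%R * ((phi (z.1 + K *m z.2)%R)%:E * (psi z.2)%:E))%E.
pose H (z : T) := (f z.2 * ((phi (z.1 - K *m z.2)%R)%:E * (psi z.2)%:E))%E.
have phi0 x : (0 <= (phi x)%:E)%E by rewrite lee_fin gaussian_pdf_ge0.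
have psi0 x : (0 <= (psi x)%:E)%E by rewrite lee_fin gaussian_pdf_ge0.
have mpsi1 : measurable_fun setT (EFin \o psi).
  by apply/measurable_EFinP; exact: measurable_gaussian_pdf.
have F0 z : (0 <= F z)%E by rewrite !mule_ge0.
have G0 z : (0 <= G z)%E by rewrite !mule_ge0.
have H0 z : (0 <= H z)%E by rewrite !mule_ge0.
have mF : measurable_fun setT F.
  apply: emeasurable_funM; last by apply: emeasurable_funM; [exact: mphi|exact: mpsi].
  by apply: (measurableT_comp mf); exact: measurable_mx_mulr.
have mG : measurable_fun setT G.
  apply: emeasurable_funM; last first.
    apply: emeasurable_funM; last exact: mpsi.
    by apply: (mphi (fun z : T => z.1 + K *m z.2));
      apply: measurable_mxD => //; exact: measurable_mx_mulr.
  by apply: (measurableT_comp mf); apply: measurable_mxD => //; exact: measurable_mx_mulr.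
have mH : measurable_fun setT H.
  apply: emeasurable_funM; first exact: (measurableT_comp mf).
  apply: emeasurable_funM; last exact: mpsi.
  by apply: (mphi (fun z : T => z.1 - K *m z.2));
    apply: measurable_mxB => //; exact: measurable_mx_mulr.
transitivity (\int[mu n]_x \int[mu r]_w F (x, w))%E.
  apply: eq_integral => x _; rewrite /F /=; under eq_integral do rewrite muleA.
  have k0 : (0 <= f (A *m x) * (phi x)%:E)%E by exact: mule_ge0.
  by rewrite (ge0_integralZlT (mu r) mpsi1 psi0 k0) integral_gaussian_pdf// mule1.
rewrite (fubini_tonelli F mF F0).
transitivity (\int[mu r]_w \int[mu n]_x G (x, w))%E.
  apply: eq_integral => w _.
  have mFw : measurable_fun setT (fun x => F (x, w)).
    exact: (measurableT_comp mF (pair2_measurable w)).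
  rewrite -(integral_shift_cV (K *m w) mFw (fun x => F0 (x, w))).
  by apply: eq_integral => x _; rewrite /F /G /= mulmxDr mulmxA AK mul1mx.
rewrite -(fubini_tonelli G mG G0).
transitivity (\int[mu n]_x \int[mu r]_w H (x, w))%E.
  apply: eq_integral => x _.
  have mGx : measurable_fun setT (fun w => G (x, w)).
    exact: (measurableT_comp mG (pair1_measurable x)).
  rewrite -(integral_shift_cV (- (A *m x)) mGx (fun w => G0 (x, w))).
  apply: eq_integral => w _; rewrite /G /H /= addrC subrK.
  by rewrite -!EFinM pdfM.
rewrite (fubini_tonelli H mH H0).
apply: eq_integral => w _; rewrite /H /=.
under eq_integral do rewrite (muleC (phi _)%:E) muleA /phi -gaussian_pdf_center.
have k0 : (0 <= f w * (psi w)%:E)%E by exact: mule_ge0.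
have mphiw : measurable_fun setT (EFin \o gaussian_pdf (K *m w) C).
  by apply/measurable_EFinP; exact: measurable_gaussian_pdf.
have phiw0 x : (0 <= (EFin \o gaussian_pdf (K *m w) C) x)%E.
  by rewrite lee_fin gaussian_pdf_ge0.
by rewrite (ge0_integralZlT (mu n) mphiw phiw0 k0) integral_gaussian_pdf// mule1.
Qed.

Lemma integral_gaussian_image (m : 'cV[R]_n) (f : 'cV[R]_r -> \bar R) :
  measurable_fun setT f -> (forall w, 0 <= f w)%E ->
  (\int[mu n]_x (f (A *m x) * (gaussian_pdf m C x)%:E) =
   \int[mu r]_w (f w * (gaussian_pdf (A *m m) S w)%:E))%E.
Proof.
move=> mf f0.
have mg (k : nat) (N : 'M[R]_k) (c : 'cV[R]_k) (g : 'cV[R]_k -> \bar R) : measurable_fun setT g ->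
    measurable_fun setT (fun x => g x * (gaussian_pdf c N x)%:E)%E.
  move=> ?; apply: emeasurable_funM => //.
  by apply/measurable_EFinP; exact: measurable_gaussian_pdf.
have g0 (k : nat) (N : 'M[R]_k) (c : 'cV[R]_k) (g : 'cV[R]_k -> \bar R) : (forall x, 0 <= g x)%E ->
    (forall x, 0 <= g x * (gaussian_pdf c N x)%:E)%E.
  by move=> ? x; rewrite mule_ge0// lee_fin gaussian_pdf_ge0.
have mfA : measurable_fun setT (fun x => f (A *m x)).
  by apply: (measurableT_comp mf); exact: measurable_mx_mulr.
rewrite -(integral_shift_cV m (mg _ _ _ _ mfA) (g0 _ _ _ _ (fun x => f0 _))).
under eq_integral do rewrite gaussian_pdf_center addrK mulmxDr.
have mfm : measurable_fun setT (fun w : 'cV[R]_r => f (w + A *m m)).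
  by apply: (measurableT_comp mf); exact: measurable_mxD.
rewrite (integral_gaussian_image0 mfm) => [|w]; last exact: f0.
rewrite -[RHS](integral_shift_cV (A *m m) (mg _ _ _ _ mf) (g0 _ _ _ _ f0)).
by apply: eq_integral => w _; rewrite [gaussian_pdf (A *m m) _ _]gaussian_pdf_center addrK.
Qed.

End gaussian_image.

Lemma integral_set_indic d (T : measurableType d) (R : realType)
    (mu : {measure set T -> \bar R}) (D : set T) (f : T -> \bar R) :
  (\int[mu]_(x in D) f x = \int[mu]_x ((\1_D x)%:E * f x))%E.
Proof.
rewrite integral_mkcond epatch_indic; apply: eq_integral => x _.
by rewrite muleC.
Qed.

Section gaussian_rv.
Context d (Omega : measurableType d) (R : realType) (P : probability Omega R).

Lemma gaussian_mulmx n r (Z : {RV P >-> 'cV[R]_n}) m (C : 'M[R]_n) (A : 'M[R]_(r, n)) :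
  sym_posdef C -> sym_posdef (A *m C *m A^T) -> is_gaussian Z m C ->
  is_gaussian (rv_mulmx A Z : {RV P >-> 'cV[R]_r}) (A *m m) (A *m C *m A^T).
Proof.
move=> sC sS [_ _ ZE]; split => [|x|D mD].
- by apply: measurable_gaussian_pdf.
- exact: gaussian_pdf_ge0.
have mA : measurable_fun setT (fun x : 'cV[R]_n => A *m x) by exact: measurable_mx_mulr.
have mDA : measurable ((fun x : 'cV[R]_n => A *m x) @^-1` D).
  by rewrite -[X in measurable X]setTI; exact: mA.
rewrite [LHS](ZE _ mDA) integral_set_indic [RHS]integral_set_indic.
have mD1 : measurable_fun setT (EFin \o (\1_D : 'cV[R]_r -> R)).
  by apply/measurable_EFinP.
have D1 w : (0 <= (EFin \o (\1_D : 'cV[R]_r -> R)) w)%E by rewrite lee_fin.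
by rewrite -(integral_gaussian_image sC sS m mD1 D1).
Qed.

End gaussian_rv.

(** * Continuity and uniqueness of continuous densities *)

Section continuity.
Context {R : realType} {T : topologicalType}.

Lemma continuous_sum_ord n (F : 'I_n -> T -> R) :
  (forall i, continuous (F i)) -> continuous (fun t => \sum_i F i t).
Proof. by move=> cF; apply: continuous_big => //; exact: add_continuous. Qed.

(** Stated entry by entry because the quadratic form is expanded into a finite sum of products of
    entries. *)
Definition coord_cont m (u : T -> 'cV[R]_m) : Prop :=
  forall i, continuous (fun t => u t i 0).

Lemma coord_cont_cst m (c : 'cV[R]_m) : coord_cont (fun=> c).
Proof. by move=> i t; exact: cvg_cst. Qed.

Lemma coord_contB m (u v : T -> 'cV[R]_m) :
  coord_cont u -> coord_cont v -> coord_cont (fun t => u t - v t).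
Proof.
move=> cu cv i; rewrite (_ : (fun t => _) = (fun t => u t i 0 - v t i 0)); last first.
  by apply/funext => t; rewrite !mxE.
by move=> t; apply: cvgB; [exact: cu|exact: cv].
Qed.

Lemma coord_contM m n (A : 'M[R]_(m, n)) (u : T -> 'cV[R]_n) :
  coord_cont u -> coord_cont (fun t => A *m u t).
Proof.
move=> cu i; rewrite (_ : (fun t => _) = (fun t => \sum_j A i j * u t j 0)); last first.
  by apply/funext => t; rewrite !mxE.
by apply: continuous_sum_ord => j t; apply: cvgM; [exact: cvg_cst|exact: cu].
Qed.

Lemma continuous_bform m n (M : 'M[R]_(m, n)) (u : T -> 'cV[R]_m) (v : T -> 'cV[R]_n) :
  coord_cont u -> coord_cont v -> continuous (fun t => bform M (u t) (v t)).
Proof.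
move=> cu cv; rewrite (_ : (fun t => _) =
    (fun t => \sum_i \sum_j u t i 0 * M i j * v t j 0)); last first.
  by apply/funext => t; rewrite bform_sumE.
apply: continuous_sum_ord => i; apply: continuous_sum_ord => j t.
by apply: cvgM; [apply: cvgM; [exact: cu|exact: cvg_cst]|exact: cv].
Qed.

Lemma continuous_gaussian_pdf n (m : 'cV[R]_n) C (u : T -> 'cV[R]_n) :
  coord_cont u -> continuous (fun t => gaussian_pdf m C (u t)).
Proof.
move=> cu t; apply: cvgM; first exact: cvg_cst.
apply: (@continuous_comp _ _ _ (fun t => - bform (invmx C) (u t - m) (u t - m) / 2) expR).
  apply: cvgM; last exact: cvg_cst.
  apply: cvgN; apply: continuous_bform; apply: coord_contB => //; exact: coord_cont_cst.
exact: continuous_expR.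
Qed.

End continuity.

Section full_support.
Context {R : realType}.

(* N x is the neighbourhood filter of x; it is a parameter because no structure
   bundles the measurable and the topological structure of column vectors. *)
Definition full_support d (T : measurableType d) (N : T -> set_system T)
    (mu : set T -> \bar R) : Prop :=
  forall x U, N x U -> exists B, [/\ measurable B, B `<=` U & (0 < mu B)%E].

(** A neighbourhood of x contains a box of balls, whose measure is a product of positive lengths. *)
Lemma full_support_lebesgue_cV n :
  full_support (fun x : 'cV[R]_n => nbhs x) (@lebesgue_cV R n).
Proof.
move=> x U [Q Qx QU].
have /choice[e eQ] : forall i, exists e : R, 0 < e /\ ball (x i 0) e `<=` Q i 0.
  by move=> i; have /nbhs_ballP[e e0 eQ] := Qx i 0; exists e.
exists [set v : 'cV[R]_n | forall i, ball (x i 0) (e i) (v i 0)]; split.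
- rewrite (_ : mkset _ = \bigcap_(i in [set: 'I_n])
      ((fun v : 'cV[R]_n => v i 0) @^-1` ball (x i 0) (e i))); last first.
    by apply/seteqP; split=> [v vA i _|v vA i]; [exact: vA|exact: (vA i I)].
  apply: fin_bigcap_measurable => // i _; rewrite -[X in measurable X]setTI.
  by apply: measurable_mxcoord => //; exact: measurable_ball.
- by move=> v vA; apply: QU => i j; rewrite ord1; apply: (eQ i).2.
- rewrite (lebesgue_cV_box (A := fun i => ball (x i 0) (e i))); last first.
    by move=> i; exact: measurable_ball.
  elim/big_ind: _ => // [a b|i _]; first exact: mule_gt0.
  by rewrite lebesgue_measure_ball ?lte_fin ?mulrn_wgt0 ?ltW//; case: (eQ i).
Qed.

Lemma full_support_prod m n :
  full_support (fun x : 'cV[R]_m * 'cV[R]_n => nbhs x)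
    (@lebesgue_cV R m \x @lebesgue_cV R n)%E.
Proof.
move=> [x y] U [[U1 U2] [/= xU1 yU2] UU].
have [B1 [mB1 BU1 B10]] := full_support_lebesgue_cV xU1.
have [B2 [mB2 BU2 B20]] := full_support_lebesgue_cV yU2.
exists (B1 `*` B2); split; first exact: measurableX.
- by move=> [a b] [/= /BU1 ? /BU2 ?]; exact: UU.
- by rewrite product_measure1E// mule_gt0.
Qed.

(** If f and g differ at x, they differ on a neighbourhood, hence on a set of positive measure,
    although densities of the same law agree almost everywhere. This identifies the densities that
    [conditional_pdf] selects. *)
Lemma continuous_density_eq d (T : measurableType d) (N : T -> set_system T)
    (mu nu : {measure set T -> \bar R}) (f g : T -> R) :
  (forall x, Filter (N x)) -> full_support N mu -> (nu setT < +oo)%E ->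
  is_density mu nu f -> is_density mu nu g ->
  (forall x, f @ N x --> f x) -> (forall x, g @ N x --> g x) -> f =1 g.
Proof.
move=> FN supp nuoo df dg cf cg x; apply/eqP/negPn/negP => fgx.
have [M [mM M0 fgM]] := is_density_ae_eq df dg nuoo.
have cfg : (fun y => f y - g y) @ N x --> f x - g x by apply: cvgB.
have fg0 : f x - g x != 0 by rewrite subr_eq0.
have U0 : N x [set y | f y - g y != 0] by apply: cvgr_neq0 cfg fg0.
have [B [mB BU B0]] := supp _ _ U0.
have : (mu B <= mu M)%E.
  apply: le_measure; rewrite ?inE// => y /BU /= fgy; apply: fgM => /= H.
  by have [fy] := H I; move: fgy; rewrite fy subrr eqxx.
by rewrite M0 leNgt B0.
Qed.

End full_support.

(** * The joint law and the posterior *)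

Section gaussian_regression.
Context {R : realType} q r (CX : 'M[R]_q) (S : 'M[R]_r) (A : 'M[R]_(r, q)).
Variables (mX : 'cV[R]_q) (b : 'cV[R]_r).
Hypotheses (sX : sym_posdef CX) (sS : sym_posdef S).
Local Notation mu n := (@lebesgue_cV R n).

Definition evidence_cov : 'M[R]_r := A *m CX *m A^T + S.
Definition evidence_mean : 'cV[R]_r := A *m mX + b.
Definition posterior_cov : 'M[R]_q := invmx (invmx CX + A^T *m invmx S *m A).
Definition posterior_mean (w : 'cV[R]_r) : 'cV[R]_q :=
  mX + CX *m A^T *m invmx evidence_cov *m (w - evidence_mean).
Definition joint_pdf (z : 'cV[R]_r * 'cV[R]_q) : R :=
  gaussian_pdf mX CX z.2 * gaussian_pdf b S (z.1 - A *m z.2).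

Lemma spd_evidence_cov : sym_posdef evidence_cov.
Proof. exact: spd_addl. Qed.

Lemma spd_posterior_cov : sym_posdef posterior_cov.
Proof. by apply: spd_inv; exact: spd_posterior_precision. Qed.

Lemma det_posterior_cov : \det posterior_cov * \det evidence_cov = \det CX * \det S.
Proof.
rewrite /evidence_cov -(det_posterior_precision A sX sS) det_inv -!mulrA mulKf//.
by rewrite gt_eqF// spd_det_gt0//; exact: spd_posterior_precision.
Qed.

(** Bayes' formula: the constants agree by [det_posterior_cov], the exponents by
    [complete_square_posterior]. *)
Lemma joint_pdfE w x : joint_pdf (w, x) =
  gaussian_pdf evidence_mean evidence_cov w *
  gaussian_pdf (posterior_mean w) posterior_cov x.
Proof.
rewrite /joint_pdf /= !gaussian_pdfE mulrACA [RHS]mulrACA -!expRD.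
congr (_ * expR _).
  rewrite -!invfM /gaussian_norm -!sqrtrM; last 2 first.
  - by rewrite mulr_ge0 ?exprn_ge0 ?mulr_ge0 ?pi_ge0// ltW// spd_det_gt0//; exact: spd_evidence_cov.
  - by rewrite mulr_ge0 ?exprn_ge0 ?mulr_ge0 ?pi_ge0// ltW// spd_det_gt0.
  congr (Num.sqrt _)^-1.
  rewrite mulrACA -det_posterior_cov (mulrC (\det posterior_cov)).
  by rewrite [in RHS]mulrACA (mulrC (_ ^+ r)).
rewrite -!mulrDl -!opprD; congr (- _ / 2).
rewrite /posterior_cov invmxK.
have -> : x - posterior_mean w = x - mX -
    CX *m A^T *m invmx evidence_cov *m (w - evidence_mean).
  by rewrite /posterior_mean opprD addrA.
have -> : w - A *m x - b = w - evidence_mean - A *m (x - mX).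
  rewrite /evidence_mean mulmxBr; move: (A *m x) (A *m mX) => c a.
  by apply/matrixP => i j; rewrite !mxE; ring.
exact: complete_square_posterior.
Qed.

Lemma joint_pdf_ge0 z : 0 <= joint_pdf z.
Proof. by rewrite mulr_ge0 ?gaussian_pdf_ge0. Qed.

Lemma measurable_joint_pdf : measurable_fun setT joint_pdf.
Proof.
apply: measurable_funM; apply: measurable_gaussian_pdf => //.
by apply: measurable_mxB => //; exact: measurable_mx_mulr.
Qed.

Lemma continuous_joint_pdf : continuous joint_pdf.
Proof.
have c1 : coord_cont (fun z : 'cV[R]_r * 'cV[R]_q => z.1).
  by move=> i z; apply: (@continuous_comp _ _ _ fst (fun v : 'cV[R]_r => v i 0));
    [exact: cvg_fst|exact: coord_continuous].
have c2 : coord_cont (fun z : 'cV[R]_r * 'cV[R]_q => z.2).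
  by move=> i z; apply: (@continuous_comp _ _ _ snd (fun v : 'cV[R]_q => v i 0));
    [exact: cvg_snd|exact: coord_continuous].
have k1 := continuous_gaussian_pdf (m := mX) (C := CX) c2.
have k2 := continuous_gaussian_pdf (m := b) (C := S) (coord_contB c1 (coord_contM (A := A) c2)).
by move=> z; apply: cvgM; [exact: k1|exact: k2].
Qed.

Context d (Omega : measurableType d) (P : probability Omega R).
Variables (W : {RV P >-> 'cV[R]_r}) (X : {RV P >-> 'cV[R]_q}) (F : {RV P >-> 'cV[R]_r}).
Hypothesis WE : forall t, W t = A *m X t + F t.
Hypotheses (gX : is_gaussian X mX CX) (gF : is_gaussian F b S).
Hypothesis XF : independent_rv X F.

(** By independence the law of (X, F) is a product, and (W, X) is its image under the shear [phi].
    At fixed x the shear is a translation by A x, so Tonelli and translation invariance give the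
    density. *)
Lemma is_density_joint :
  is_density (mu r \x mu q)%E (distribution P (rv_pair W X)) joint_pdf.
Proof.
split; [exact: measurable_joint_pdf|exact: joint_pdf_ge0|move=> D mD].
pose phi (z : 'cV[R]_q * 'cV[R]_r) : 'cV[R]_r * 'cV[R]_q := (A *m z.1 + z.2, z.1).
have mphi : measurable_fun setT phi.
  by apply: measurable_fun_pair => //; apply: measurable_mxD => //; exact: measurable_mx_mulr.
have mD' : measurable (phi @^-1` D) by rewrite -[X in measurable X]setTI; exact: mphi.
have mD1 : measurable_fun setT (EFin \o (\1_D : 'cV[R]_r * 'cV[R]_q -> R)).
  exact/measurable_EFinP.
have -> : distribution P (rv_pair W X) D = distribution P (rv_pair X F) (phi @^-1` D).
  rewrite /distribution /pushforward; congr (P _).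
  by apply/seteqP; split => t; rewrite /= /rv_pair /phi /= WE.
have <- : (distribution P X \x distribution P F)%E (phi @^-1` D) =
    distribution P (rv_pair X F) (phi @^-1` D).
  by apply: product_measure_unique => // B C mB mC; rewrite -XF.
pose h z := ((\1_D (phi z))%:E : \bar R).
have mh : measurable_fun setT h by exact: (measurableT_comp mD1 mphi).
have h0 z : (0 <= h z)%E by rewrite lee_fin.
transitivity (\int[distribution P X \x distribution P F]_z h z)%E.
  by rewrite -[LHS]/(_ (phi @^-1` D)) -[phi @^-1` D]setIT -integral_indic.
rewrite (fubini_tonelli1 h mh h0).
rewrite (integral_is_density gX); last 2 first.
- exact: (measurable_fun_fubini_tonelli_F h mh h0).
- by move=> x; exact: integral_ge0.
rewrite [RHS]integral_set_indic.
pose g z := ((\1_D z)%:E * (joint_pdf z)%:E)%E.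
have mg : measurable_fun setT g.
  by apply: emeasurable_funM => //; apply/measurable_EFinP; exact: measurable_joint_pdf.
have g0 z : (0 <= g z)%E by rewrite mule_ge0 ?lee_fin ?joint_pdf_ge0.
rewrite -[RHS]/(\int[mu r \x mu q]_z g z)%E [RHS](fubini_tonelli2 g mg g0).
apply: eq_integral => x _; rewrite /fubini_F /fubini_G.
have mgx : measurable_fun setT (fun w => g (w, x)).
  exact: (measurableT_comp mg (pair2_measurable x)).
have mhx : measurable_fun setT (fun f => h (x, f)).
  exact: (measurableT_comp mh (pair1_measurable x)).
rewrite -(integral_shift_cV (A *m x) mgx (fun w => g0 (w, x))).
rewrite (integral_is_density gF mhx) => [|f]; last exact: h0.
have mgf : measurable_fun setT (fun f => h (x, f) * (gaussian_pdf b S f)%:E)%E.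
  by apply: emeasurable_funM => //; apply/measurable_EFinP; exact: measurable_gaussian_pdf.
have gf0 f : (0 <= h (x, f) * (gaussian_pdf b S f)%:E)%E.
  by rewrite mule_ge0 ?lee_fin ?gaussian_pdf_ge0.
have k0 : (0 <= (gaussian_pdf mX CX x)%:E)%E by rewrite lee_fin gaussian_pdf_ge0.
rewrite muleC -(ge0_integralZlT (mu r) mgf gf0 k0).
apply: eq_integral => f _; rewrite /g /h /phi /joint_pdf /= addrK addrC muleCA.
by rewrite -EFinM.
Qed.

(** Marginalise the joint density over x in the form [joint_pdfE]: the posterior factor integrates
    to 1 for each w. *)
Lemma is_density_evidence : is_gaussian W evidence_mean evidence_cov.
Proof.
split => [|w|D mD]; [exact: measurable_gaussian_pdf|exact: gaussian_pdf_ge0|].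
have [_ _ jE] := is_density_joint.
have mDT : measurable (D `*` [set: 'cV[R]_q]) by exact: measurableX.
transitivity (distribution P (rv_pair W X) (D `*` setT)).
  by rewrite /distribution /pushforward; congr (P _); apply/seteqP; split => t // [].
rewrite jE// [LHS]integral_set_indic [RHS]integral_set_indic.
pose g z := ((\1_(D `*` [set: 'cV[R]_q]) z)%:E * (joint_pdf z)%:E)%E.
have mg : measurable_fun setT g.
  apply: emeasurable_funM; last by apply/measurable_EFinP; exact: measurable_joint_pdf.
  by apply/measurable_EFinP; exact: measurable_indic.
have g0 z : (0 <= g z)%E by rewrite mule_ge0 ?lee_fin ?joint_pdf_ge0.
rewrite -[LHS]/(\int[mu r \x mu q]_z g z)%E [LHS](fubini_tonelli1 g mg g0).
apply: eq_integral => w _; rewrite /fubini_F /g.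
have E x : ((\1_(D `*` [set: 'cV[R]_q]) (w, x))%:E * (joint_pdf (w, x))%:E =
    ((\1_D w)%:E * (gaussian_pdf evidence_mean evidence_cov w)%:E) *
    (gaussian_pdf (posterior_mean w) posterior_cov x)%:E)%E.
  rewrite joint_pdfE EFinM muleA; congr (_%:E * _ * _)%E.
  have DTE : ((w, x) \in D `*` [set: 'cV[R]_q]) = (w \in D).
    by apply/idP/idP; rewrite !inE => //= -[].
  by rewrite !indicE DTE.
under eq_integral do rewrite E.
rewrite ge0_integralZlT ?integral_gaussian_pdf ?mule1//.
- exact: spd_posterior_cov.
- by apply/measurable_EFinP; exact: measurable_gaussian_pdf.
- by move=> x; rewrite lee_fin gaussian_pdf_ge0.
- by rewrite mule_ge0 ?lee_fin ?gaussian_pdf_ge0.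
Qed.

End gaussian_regression.

(** * Entropies and mutual information of the Gaussian model *)

Section gaussian_entropy.
Context {R : realType}.
Local Notation mu n := (@lebesgue_cV R n).

Lemma ln_gaussian_norm n (C : 'M[R]_n) : sym_posdef C ->
  ln (gaussian_norm C) = n%:R / 2 * ln (2 * pi) + 2^-1 * ln (\det C).
Proof.
move=> sC; have dC := spd_det_gt0 sC; have N0 := gaussian_norm_gt0 sC.
have p0 : 0 < 2 * pi :> R by rewrite mulr_gt0// pi_gt0.
have E : ln (gaussian_norm C) *+ 2 = n%:R * ln (2 * pi) + ln (\det C).
  rewrite -lnXn// sqr_sqrtr; last by rewrite ltW// mulr_gt0// exprn_gt0.
  by rewrite lnM ?posrE ?exprn_gt0// lnXn// -[ln _ *+ n]mulr_natl.
have -> : ln (gaussian_norm C) = (ln (gaussian_norm C) *+ 2) / 2 by field.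
by rewrite E; field.
Qed.

Lemma measurable_bform_center n (M : 'M[R]_n) (m : 'cV[R]_n) :
  measurable_fun setT (fun x : 'cV[R]_n => bform M (x - m) (x - m)).
Proof. by apply: measurable_bform; exact: measurable_mxB. Qed.

Lemma entropy_gaussian_pdf n (nu : {measure set 'cV[R]_n -> \bar R}) m C :
  sym_posdef C -> nu setT = 1%E -> is_density (mu n) nu (gaussian_pdf m C) ->
  entropy (mu n) nu = (ln (gaussian_norm C) + n%:R / 2)%:E.
Proof.
move=> sC nu1 dnu; apply: (@entropy_exp_density _ _ _ (mu n) nu _
    (fun x => bform (invmx C) (x - m) (x - m)) _ _ dnu nu1).
- exact: measurable_bform_center.
- by move=> x; rewrite spd_ge0//; exact: spd_inv.
- by move=> x; exact: ln_gaussian_pdf.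
- exact: integral_bform_gaussian.
Qed.

End gaussian_entropy.

Section gaussian_information.
Context {R : realType} q r (CX : 'M[R]_q) (S : 'M[R]_r) (A : 'M[R]_(r, q)).
Variables (mX : 'cV[R]_q) (b : 'cV[R]_r).
Hypotheses (sX : sym_posdef CX) (sS : sym_posdef S).
Local Notation mu n := (@lebesgue_cV R n).
Context d (Omega : measurableType d) (P : probability Omega R).
Variables (W : {RV P >-> 'cV[R]_r}) (X : {RV P >-> 'cV[R]_q}) (F : {RV P >-> 'cV[R]_r}).
Hypothesis WE : forall t, W t = A *m X t + F t.
Hypotheses (gX : is_gaussian X mX CX) (gF : is_gaussian F b S).
Hypothesis XF : independent_rv X F.

Let joint := joint_pdf CX S A mX b.
Let T := evidence_cov CX S A.

(** The factorisation of the joint density into prior and noise is used here: -ln of it carries one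
    quadratic form of mean q and one of mean r, which amounts to H(X) + H(F). *)
Lemma gaussian_joint_entropy : joint_entropy W X =
  (ln (gaussian_norm CX) + ln (gaussian_norm S) + (q%:R + r%:R) / 2)%:E.
Proof.
pose QX x := bform (invmx CX) (x - mX) (x - mX).
pose QF (z : 'cV[R]_r * 'cV[R]_q) :=
  bform (invmx S) (z.1 - A *m z.2 - b) (z.1 - A *m z.2 - b).
have QX0 x : 0 <= QX x by rewrite spd_ge0//; exact: spd_inv.
have QF0 z : 0 <= QF z by rewrite spd_ge0//; exact: spd_inv.
have mQX : measurable_fun setT (fun z : 'cV[R]_r * 'cV[R]_q => QX z.2).
  by apply: measurable_bform; exact: measurable_mxB.
have mQF : measurable_fun setT QF.
  have mz : measurable_fun setT (fun z : 'cV[R]_r * 'cV[R]_q => z.1 - A *m z.2 - b).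
    by apply: measurable_mxB => //; apply: measurable_mxB => //; exact: measurable_mx_mulr.
  exact: measurable_bform.
have mj : measurable_fun setT joint by exact: measurable_joint_pdf.
have j0 z : 0 <= joint z by exact: joint_pdf_ge0.
(* At fixed x the noise factor is the density of N(A x + b, S) in w; both integrals below are taken
   over w first. *)
have pdfF (w : 'cV[R]_r) x : gaussian_pdf b S (w - A *m x) = gaussian_pdf (A *m x + b) S w.
  by rewrite [LHS]gaussian_pdf_center [RHS]gaussian_pdf_center opprD addrA.
apply: (entropy_exp_density (is_density_joint WE gX gF XF)
    (Q := fun z => QX z.2 + QF z)).
- exact: probability_setT.
- exact: measurable_funD.
- by move=> z; rewrite addr_ge0.
- move=> z; rewrite lnM ?posrE ?gaussian_pdf_gt0// opprD !ln_gaussian_pdf//.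
  by rewrite /QX /QF; ring.
have m1 : measurable_fun setT (fun z => (QX z.2 * joint z)%:E).
  by apply/measurable_EFinP; exact: measurable_funM.
have m2 : measurable_fun setT (fun z => (QF z * joint z)%:E).
  by apply/measurable_EFinP; exact: measurable_funM.
have p1 z : (0 <= (QX z.2 * joint z)%:E)%E by rewrite lee_fin mulr_ge0.
have p2 z : (0 <= (QF z * joint z)%:E)%E by rewrite lee_fin mulr_ge0.
under eq_integral do rewrite mulrDl EFinD.
rewrite (@ge0_integralD _ _ _ (mu r \x mu q)%E setT measurableT _ _
  (fun z _ => p1 z) m1 (fun z _ => p2 z) m2).
rewrite EFinD; congr (_ + _)%E.
- rewrite (fubini_tonelli2 _ m1 p1) -(integral_bform_gaussian mX sX).
  apply: eq_integral => x _; rewrite /fubini_G /joint /joint_pdf /=.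
  under eq_integral do rewrite mulrA pdfF.
  rewrite ge0_integralZlR ?integral_gaussian_pdf ?mule1//.
  + exact: measurable_gaussian_pdf.
  + by move=> w; exact: gaussian_pdf_ge0.
  + by rewrite mulr_ge0 ?gaussian_pdf_ge0.
- rewrite (fubini_tonelli2 _ m2 p2).
  transitivity (\int[mu q]_x (r%:R * gaussian_pdf mX CX x)%:E)%E; last first.
    rewrite ge0_integralZlR ?integral_gaussian_pdf ?mule1//.
    + exact: measurable_gaussian_pdf.
    + by move=> w; exact: gaussian_pdf_ge0.
  apply: eq_integral => x _; rewrite /fubini_G /joint /joint_pdf /=.
  under eq_integral do rewrite mulrCA pdfF /QF /= -addrA -opprD.
  rewrite ge0_integralZlR ?integral_bform_gaussian//.
  + by rewrite -EFinM mulrC.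
  + by apply: measurable_funM; [exact: measurable_bform_center|exact: measurable_gaussian_pdf].
  + by move=> w; rewrite mulr_ge0 ?gaussian_pdf_ge0// spd_ge0//; exact: spd_inv.
  + exact: gaussian_pdf_ge0.
Qed.

Lemma gaussian_mutual_information : mutual_information W X =
  (2^-1 * (ln (\det T) - ln (\det S)))%:E.
Proof.
have sT : sym_posdef T by exact: spd_evidence_cov.
have gW := is_density_evidence sX sS WE gX gF XF.
rewrite /mutual_information gaussian_joint_entropy /rv_entropy.
rewrite (entropy_gaussian_pdf sT (probability_setT _) gW).
rewrite (entropy_gaussian_pdf sX (probability_setT _) gX).
rewrite -EFinN -!EFinD !ln_gaussian_norm//; congr (_%:E).
by field.
Qed.

(** Valid at every w, not just almost every one: both selected densities are continuous, so they
    equal the explicit ones pointwise, and by [joint_pdfE] the evidence factor cancels. *)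
Lemma conditional_pdfE w x : conditional_pdf W X w x =
  gaussian_pdf (posterior_mean CX S A mX b w) (posterior_cov CX S A) x.
Proof.
have dj := is_density_joint WE gX gF XF.
have gW := is_density_evidence sX sS WE gX gF XF.
have cj : continuous joint by exact: continuous_joint_pdf.
pose pW := gaussian_pdf (evidence_mean A mX b) T.
have cW : continuous pW.
  by apply: (@continuous_gaussian_pdf _ _ _ _ _ id) => i; exact: coord_continuous.
have jfin : (distribution P (rv_pair W X) setT < +oo)%E.
  by rewrite probability_setT ltry.
have Wfin : (distribution P W setT < +oo)%E by rewrite probability_setT ltry.
rewrite /conditional_pdf; set fj := density_in _ _ _; set fW := density_in _ _ _.
(* The selection cannot fall back to 0, since [joint] is itself a continuous density. *)
have -> : fj = joint.
  rewrite /fj /density_in; case: xgetP => [g _ [cg dg]|/(_ joint)/= H]; last by case: H.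
  apply/funext; apply: (continuous_density_eq _ (@full_support_prod R r q) jfin dg dj) => //.
have -> : fW = pW.
  rewrite /fW /density_in; case: xgetP => [g _ [cg dg]|/(_ pW)/= H]; last by case: H.
  apply/funext; apply: (continuous_density_eq _ (@full_support_lebesgue_cV R r) Wfin dg gW) => //.
rewrite /joint joint_pdfE// mulrAC divff ?mul1r//.
by rewrite gt_eqF// gaussian_pdf_gt0//; exact: spd_evidence_cov.
Qed.

Lemma posterior_entropy w : entropy (mu q) (posterior W X w) =
  (ln (gaussian_norm (posterior_cov CX S A)) + q%:R / 2)%:E.
Proof.
have sP := spd_posterior_cov A sX sS.
have postE D : posterior W X w D = (\int[mu q]_(x in D)
    (gaussian_pdf (posterior_mean CX S A mX b w) (posterior_cov CX S A) x)%:E)%E.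
  by apply: eq_integral => x _; rewrite conditional_pdfE.
pose nu : {measure set 'cV[R]_q -> \bar R} := posterior W X w.
have nu1 : nu setT = 1%E by rewrite [LHS]postE integral_gaussian_pdf.
have dnu : is_density (mu q) nu
    (gaussian_pdf (posterior_mean CX S A mX b w) (posterior_cov CX S A)).
  by split => [|x|D mD]; [exact: measurable_gaussian_pdf|exact: gaussian_pdf_ge0|exact: postE].
exact: entropy_gaussian_pdf sP nu1 dnu.
Qed.

Lemma posterior_entropyE w : entropy (mu q) (posterior W X w) =
  (- mutual_information W X + (2^-1 * ln (\det CX) +
    q%:R / 2 * ln (2 * pi * expR 1))%:E)%E.
Proof.
have sP := spd_posterior_cov A sX sS; have sT := spd_evidence_cov A sX sS.
rewrite posterior_entropy gaussian_mutual_information -EFinN -EFinD; congr (_%:E).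
have p0 : 0 < 2 * pi :> R by rewrite mulr_gt0// pi_gt0.
(* The factor e absorbs the term q/2 coming from the mean of the quadratic form. *)
have -> : ln (2 * pi * expR 1) = ln (2 * pi) + 1 :> R.
  by rewrite lnM ?posrE ?expR_gt0// expRK.
have dE : ln (\det (posterior_cov CX S A)) + ln (\det T) = ln (\det CX) + ln (\det S).
  by rewrite -!lnM ?posrE ?spd_det_gt0// det_posterior_cov.
by rewrite ln_gaussian_norm//; lra.
Qed.

End gaussian_information.

Theorem theorem3p6 (R : realType) (d : measure_display)
    (Omega : measurableType d)
    (P : probability Omega R) (n q r : nat) (B : 'M[R]_(n, q))
    (mX : 'cV[R]_q) (CX : 'M[R]_q) (mE : 'cV[R]_n) (CE : 'M[R]_n)
    (X : {RV P >-> 'cV[R]_q}) (E : {RV P >-> 'cV[R]_n})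
    (spdX : sym_posdef CX) (spdE : sym_posdef CE)
    (gaussX : is_gaussian X mX CX) (gaussE : is_gaussian E mE CE)
    (indepXE : independent_rv X E)
    (r_ge1 : (1 <= r)%N) (r_le_n : (r <= n)%N) :
  let Y : {RV P >-> 'cV[R]_n} := rv_add (rv_mulmx B X) E in
  let CY : 'M[R]_n := B *m CX *m B^T + CE in
  let W (V : 'M[R]_(n, r)) : {RV P >-> 'cV[R]_r} := rv_mulmx V^T Y in
  let I_WX (V : 'M[R]_(n, r)) : \bar R := mutual_information (W V) X in
  let H_post (y : 'cV[R]_n) (V : 'M[R]_(n, r)) : \bar R :=
    entropy (@lebesgue_cV R q) (posterior (W V) X (V^T *m y)) in
  let D : set 'M[R]_(n, r) := [set V | full_rank V] in
  [/\ forall V, D V ->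
        I_WX V = (2^-1 * ln (\det ((V^T *m CY *m V) *m
                                   invmx (V^T *m CE *m V))))%:E /\
        forall y, H_post y V =
          (- I_WX V + (2^-1 * ln (\det CX) +
                       q%:R / 2 * ln (2 * pi * expR 1))%:E)%E,
      forall y V, is_maximizer D I_WX V <-> is_minimizer D (H_post y) V,
      exists lam : n.-tuple R, geigenvalues CY CE lam
    & forall lam : n.-tuple R, geigenvalues CY CE lam ->
        let dominant_eigenvectors (V : 'M[R]_(n, r)) := forall i : 'I_r,
          CY *m col i V = lam`_i *: (CE *m col i V) in
        [/\ is_max D I_WX (2^-1 * \sum_(i < r) ln lam`_i)%:E,
            exists V, D V /\ dominant_eigenvectors V
          & forall V, D V -> dominant_eigenvectors V ->
              is_maximizer D I_WX V]].
Proof.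
move=> Y CY W I_WX H_post D.
have sY : sym_posdef CY by exact: spd_addl.
have covE V : (V^T *m B) *m CX *m (V^T *m B)^T + V^T *m CE *m V = V^T *m CY *m V.
  by rewrite /CY mulmxDr mulmxDl trmx_mul trmxK !mulmxA.
pose F V : {RV P >-> 'cV[R]_r} := rv_mulmx V^T E.
have WE V t : W V t = (V^T *m B) *m X t + F V t.
  by rewrite /W /Y /= /rv_mulmx /rv_add mulmxDr mulmxA.
have indXF V : independent_rv X (F V).
  move=> S1 S2 mS1 mS2; apply: (indepXE S1 [set e | S2 (V^T *m e)]) => //.
  rewrite -[X in measurable X]setTI.
  exact: (@measurable_mx_mulr _ _ R _ _ _ V^T id).
have spdV V C : D V -> sym_posdef C -> sym_posdef (V^T *m C *m V).
  by move=> DV sC; apply: spd_congr => // x; exact: full_col_rank_inj.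
have gF V : D V -> is_gaussian (F V) (V^T *m mE) (V^T *m CE *m V).
  move=> DV; have := @gaussian_mulmx _ _ _ _ _ _ E mE CE V^T spdE.
  by rewrite trmxK; apply => //; exact: spdV.
have IE V : D V -> I_WX V = (2^-1 * (ln (\det (V^T *m CY *m V)) - ln (\det (V^T *m CE *m V))))%:E.
  move=> DV; rewrite /I_WX (gaussian_mutual_information spdX (spdV _ _ DV spdE)
    (WE V) gaussX (gF _ DV) (indXF V)).
  by rewrite /evidence_cov covE.
have HE y V : D V -> H_post y V = (- I_WX V + (2^-1 * ln (\det CX) +
    q%:R / 2 * ln (2 * pi * expR 1))%:E)%E.
  move=> DV; exact: (posterior_entropyE spdX (spdV _ _ DV spdE)
    (WE V) gaussX (gF _ DV) (indXF V)).
have detY V : D V -> 0 < \det (V^T *m CY *m V).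
  by move=> DV; apply: spd_det_gt0; exact: spdV.
have detE V : D V -> 0 < \det (V^T *m CE *m V).
  by move=> DV; apply: spd_det_gt0; exact: spdV.
split.
- move=> V DV; split; last by move=> y; exact: HE.
  rewrite IE// det_mulmx det_inv ln_div ?posrE ?detY ?detE//.
- move=> y V.
  (* On [D] both quantities are finite and [H_post y] is a constant minus [I_WX], so the order is
     reversed for each y. *)
  have le V1 V2 : D V1 -> D V2 -> (I_WX V1 <= I_WX V2)%E = (H_post y V2 <= H_post y V1)%E.
    by move=> D1 D2; rewrite !HE// !IE// -!EFinN -!EFinD !lee_fin lerD2r lerN2.
  split=> -[DV opt]; (split; first exact: DV) => V' DV'.
    by rewrite -(le V' V DV' DV); exact: opt.
  by rewrite (le V' V DV' DV); exact: opt.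
- by apply: geigenvalues_exists => //; exact: spd_tr.
move=> lam lamE dominant.
have lam_gt0 (i : 'I_r) : 0 < lam`_i.
  by apply: (geigenvalue_gt0 sY spdE lamE); exact: leq_trans (ltn_ord i) r_le_n.
have prod_gt0 : 0 < \prod_(i < r) lam`_i by apply: prodr_gt0 => i _.
have lnprod : ln (\prod_(i < r) lam`_i) = \sum_(i < r) ln lam`_i.
  (* Positivity is carried through the induction because ln turns a product into a sum only for
     positive factors. *)
  suff [] : 0 < \prod_(i < r) lam`_i /\ ln (\prod_(i < r) lam`_i) = \sum_(i < r) ln lam`_i by [].
  elim/big_rec2 : _ => [|i x y _ [y0 <-]]; first by rewrite ln1.
  by rewrite mulr_gt0// lnM ?posrE.
have upper V : D V -> (I_WX V <= (2^-1 * \sum_(i < r) ln lam`_i)%:E)%E.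
  move=> DV; rewrite IE// lee_fin ler_wpM2l// lerBlDr -lnprod -lnM ?posrE ?detE//.
  by rewrite ler_ln ?posrE ?mulr_gt0 ?detE ?detY//; exact: det_congr_le.
have attained V : D V -> dominant V -> I_WX V = (2^-1 * \sum_(i < r) ln lam`_i)%:E.
  move=> DV domV; rewrite IE// (det_congr_dominant domV) lnM ?posrE ?detE//.
  by rewrite lnprod addrK.
have maxim V : D V -> dominant V -> is_maximizer D I_WX V.
  by move=> DV domV; split=> // V' DV'; rewrite (attained V)//; exact: upper.
have [V [DV domV]] := dominant_eigenvectors_exist sY spdE r_le_n lamE.
split=> //; last by exists V.
by exists V; [exact: maxim|exact: attained].
Qed.
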